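(* Assume the true model: $\beta_{01},\dots,\beta_{0n}$ are i.i.d. with a fixed density $g_0$, and $\boldsymbol Y\mid\boldsymbol\beta_0\sim\mathcal N(X\boldsymbol\beta_0,\sigma^2 I_m)$, where $X\in\mathbb R^{m\times n}$ is a fixed design matrix and $\sigma^2>0$ is known ($X$ and $\sigma^2$ may depend on $(m,n)$), with $g_0$ supported on a known compact interval $[a,b]$ and satisfying $g_0\le M_0$ for a constant $M_0<\infty$. Let $L=L(m,n)$ be any sequence of truncation levels (nonnegative integers). Suppose $X$ has full column rank and that $$\frac{\sigma^2\{n+2^L\log(n+1)\}}{\lambda_{\min}(X^\top X)}\longrightarrow0\qquad\text{as } m,n\to\infty.$$ Let $\widehat{\boldsymbol\beta}(\boldsymbol Y):=\int\boldsymbol\beta\,\Pi_{L,\beta}(d\boldsymbol\beta\mid\boldsymbol Y)$ be the posterior mean of the coefficient vector under the level-$L$ truncated P\'olya tree working model. Then $$\mathbb E_{g_0}\big[\|\widehat{\boldsymbol\beta}(\boldsymbol Y)-\boldsymbol\beta_0\|_2^2\big]\longrightarrow0\qquad\text{as } m,n\to\infty.$$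
   Context: Limits are along any sequence of pairs $(m,n)$ with $m\ge n$ and $m,n\to\infty$. $\mathbb E_{g_0}$ is expectation under the true joint law of $(\boldsymbol\beta_0,\boldsymbol Y)$; $\lambda_{\min}$ denotes the smallest eigenvalue. Dyadic partition: for $l\ge0$, $[a,b]$ is partitioned into $I^l_k=[a+(b-a)k2^{-l},\,a+(b-a)(k+1)2^{-l})$ for $0\le k\le 2^l-2$ and $I^l_{2^l-1}=[b-(b-a)2^{-l},\,b]$. Truncated P\'olya tree prior $\Pi_L$ of depth $L$: let $V_{l,k}\sim\mathrm{Beta}(1,1)$ be independent for $0\le l\le L-1$, $0\le k<2^l$. Set $G(I^0_0)=1$, and recursively $G(I^{l+1}_{2k})=V_{l,k}G(I^l_k)$, $G(I^{l+1}_{2k+1})=(1-V_{l,k})G(I^l_k)$. $\Pi_L$ is the law of the random density $g(x)=\sum_{k=0}^{2^L-1}\frac{2^L}{b-a}G(I^L_k)\mathbf 1\{x\in I^L_k\}$, $x\in[a,b]$. Working model: $g\sim\Pi_L$; $\beta_1,\dots,\beta_n\mid g$ i.i.d. with density $g$; $\boldsymbol Y\mid\boldsymbol\beta\sim\mathcal N(X\boldsymbol\beta,\sigma^2I_m)$. $\Pi_{L,\beta}(\cdot\mid\boldsymbol y)$ denotes the posterior distribution of $\boldsymbol\beta=(\beta_1,\dots,\beta_n)$ given $\boldsymbol Y=\boldsymbol y$ under the working model, i.e. the distribution on $[a,b]^n$ with density proportional to $\boldsymbol\beta\mapsto\exp\{-\|\boldsymbol y-X\boldsymbol\beta\|_2^2/(2\sigma^2)\}\int\prod_{j=1}^n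 g(\beta_j)\,\Pi_L(dg)$. *)

(* Defs.v *)
From HB Require Import structures.
From mathcomp Require Import all_boot all_order all_algebra.
From mathcomp Require Import all_classical all_reals all_analysis.

Set Implicit Arguments.
Unset Strict Implicit.
Unset Printing Implicit Defensive.

Import Order.TTheory GRing.Theory Num.Theory.
Import numFieldNormedType.Exports.

Local Open Scope classical_set_scope.
Local Open Scope ring_scope.

Section cons_measure.
Context d (T : measurableType d) (R : realType) (n : nat).

Definition tuple_cons (x : T * n.-tuple T) : n.+1.-tuple T :=
  [tuple of x.1 :: x.2].

Lemma measurable_tuple_cons : measurable_fun setT tuple_cons.
Proof. exact: measurable_cons. Qed.

Variables (m1 : {sigma_finite_measure set T -> \bar R})
  (m2 : {sigma_finite_measure set (n.-tuple T) -> \bar R}).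

Definition cons_measure : set (n.+1.-tuple T) -> \bar R :=
  pushforward (m1 \x m2)%E tuple_cons.

Let cons_measure0 : cons_measure set0 = 0%E.
Proof. by rewrite /cons_measure /pushforward preimage_set0 measure0. Qed.

Let cons_measure_ge0 A : (0 <= cons_measure A)%E.
Proof. by rewrite /cons_measure /pushforward; exact: measure_ge0. Qed.

Let measurable_preimage_cons A :
  measurable A -> measurable (tuple_cons @^-1` A).
Proof.
by move=> mA; rewrite -[X in measurable X]setTI; exact: measurable_tuple_cons.
Qed.

Let cons_measure_sigma_additive : semi_sigma_additive cons_measure.
Proof.
move=> F mF tF mUF; rewrite /cons_measure /pushforward preimage_bigcup.
apply: measure_semi_sigma_additive.
- by move=> i; exact: measurable_preimage_cons.
- apply/trivIsetP => /= i j _ _ ij; rewrite -preimage_setI.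
  by move/trivIsetP : tF => /(_ _ _ _ _ ij) ->//; rewrite preimage_set0.
- by rewrite -preimage_bigcup; exact: measurable_preimage_cons.
Qed.

HB.instance Definition _ := isMeasure.Build _ _ _ cons_measure
  cons_measure0 cons_measure_ge0 cons_measure_sigma_additive.

Let cons_measure_sigma_finite : sigma_finite setT cons_measure.
Proof.
have /sigma_finiteP[F [FT ndF Foo]] := sigma_finiteT m1.
have /sigma_finiteP[G [GT ndG Goo]] := sigma_finiteT m2.
pose uncons (t : n.+1.-tuple T) : T * n.-tuple T :=
  (thead t, [tuple of behead t]).
have consK : cancel tuple_cons uncons.
  by move=> [x t]; congr pair; exact/val_inj.
have muncons : measurable_fun setT uncons.
  by apply/measurable_fun_pair; [exact: measurable_tnth|exact: measurable_behead].
exists (fun k => uncons @^-1` (F k `*` G k)).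
  rewrite -preimage_bigcup -(preimage_setT uncons); congr (_ @^-1` _).
  rewrite -setXTT FT GT predeqE => -[x y]; split.
    move=> [/= [i _ Fix] [k _ Gky]]; exists (maxn i k) => //; split.
    - by move: x Fix; exact/subsetPset/ndF/leq_maxl.
    - by move: y Gky; exact/subsetPset/ndG/leq_maxr.
  by move=> [i _ []/= ? ?]; split; exists i.
move=> k; have [mF Fk] := Foo k; have [mG Gk] := Goo k; split.
  by rewrite -[X in measurable X]setTI; apply: muncons => //; exact: measurableX.
rewrite /cons_measure /pushforward -comp_preimage (_ : uncons \o _ = id).
  by rewrite preimage_id product_measure1E// lte_mul_pinfty// ge0_fin_numE.
exact/funext/consK.
Qed.

HB.instance Definition _ := Measure_isSigmaFinite.Build _ _ _ cons_measure
  cons_measure_sigma_finite.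

End cons_measure.

Section tuple_measure.
Context d (T : measurableType d) (R : realType).
Variable mu : {sigma_finite_measure set T -> \bar R}.

(* The n-fold product measure mu \x ... \x mu. *)
Fixpoint tuple_measure (n : nat) :
    {sigma_finite_measure set (n.-tuple T) -> \bar R} :=
  match n with
  | 0 => (\d_([tuple] : 0.-tuple T))%R
  | n'.+1 => cons_measure mu (tuple_measure n')
  end.

End tuple_measure.

Section model.
Context {R : realType}.

(* The value at n = 0, where the spectrum is empty, is irrelevant. *)
Definition lambda_min (n : nat) (A : 'M[R]_n) : R :=
  inf [set x | eigenvalue A x].

Definition lebesgue_tuple (n : nat) := tuple_measure (@lebesgue_measure R) n.

Definition col_of_tuple (n : nat) (v : n.-tuple R) : 'cV[R]_n :=
  \col_i tnth v i.

Definition sqnorm2 (n : nat) (v : 'cV[R]_n) : R := \sum_i v i ord0 ^+ 2.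

Definition is_density (g : R -> R) : Prop :=
  [/\ measurable_fun setT g, forall x, 0 <= g x &
    (\int[lebesgue_measure]_x (g x)%:E = 1)%E].

Section true_model.
Variables (m n : nat) (X : 'M[R]_(m, n)) (sigma2 : R) (g0 : R -> R).

(* The joint density of (beta, Y): the coordinates of beta are i.i.d. with density
   g0, those of Y are, given beta, independent normal with means (X beta)_i and
   variance sigma2; [normal_pdf] takes the standard deviation. *)
Definition true_density (z : n.-tuple R * m.-tuple R) : R :=
  (\prod_j g0 (tnth z.1 j)) *
  \prod_i normal_pdf ((X *m col_of_tuple z.1) i ord0) (Num.sqrt sigma2)
            (tnth z.2 i).

Definition true_law (A : set (n.-tuple R * m.-tuple R)) : \bar R :=
  (\int[lebesgue_tuple n \x lebesgue_tuple m]_(z in A) (true_density z)%:E)%E.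

End true_model.

Section polya_tree.
Variables (a b : R).

Definition dyadic (l k : nat) : set R :=
  if k == (2 ^ l).-1 then `[b - (b - a) / (2 ^ l)%:R, b]%classic
  else `[a + (b - a) * k%:R / (2 ^ l)%:R,
         a + (b - a) * k.+1%:R / (2 ^ l)%:R[%classic.

Fixpoint polya_mass (V : nat -> nat -> R) (l k : nat) : R :=
  match l with
  | 0 => 1
  | l'.+1 => (if odd k then 1 - V l' k./2 else V l' k./2)
             * polya_mass V l' k./2
  end.

Definition polya_density (V : nat -> nat -> R) (L : nat) (x : R) : R :=
  \sum_(k < 2 ^ L)
    (2 ^ L)%:R / (b - a) * polya_mass V L k * \1_(dyadic L k) x.

(* The nodes (l, k), l < L, k < 2 ^ l, are numbered breadth first, hence by
   the integers below 2 ^ L - 1. *)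
Definition node (L : nat) (v : (2 ^ L).-1.-tuple R) (l k : nat) : R :=
  nth 0 v ((2 ^ l).-1 + k).

Definition polya_splits (L : nat) := tuple_measure (@beta_prob R 1 1) (2 ^ L).-1.

(* The integral of F under the prior, i.e. under the law of the random density
   [polya_density (node v) L]. *)
Definition polya_int (L : nat) (F : (R -> R) -> \bar R) : \bar R :=
  (\int[polya_splits L]_v F (polya_density (node v) L))%E.

End polya_tree.

Section posterior.
Variables (m n : nat) (X : 'M[R]_(m, n)) (sigma2 a b : R) (L : nat).

Definition cube : set (n.-tuple R) :=
  [set beta | forall j, tnth beta j \in `[a, b]].

Definition posterior_weight (y : m.-tuple R) (beta : n.-tuple R) : \bar R :=
  ((expR (- (sqnorm2 (col_of_tuple y - X *m col_of_tuple beta)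
             / (2 * sigma2))))%:E
   * polya_int a b L (fun g => (\prod_j g (tnth beta j))%:E))%E.

Definition posterior (y : m.-tuple R) (A : set (n.-tuple R)) : \bar R :=
  ((\int[lebesgue_tuple n]_(beta in cube `&` A) posterior_weight y beta)
   * ((fine (\int[lebesgue_tuple n]_(beta in cube) posterior_weight y beta))
        ^-1)%:E)%E.

Definition posterior_mean (y : m.-tuple R) : 'cV[R]_n :=
  \col_j fine (\int[posterior y]_beta (tnth beta j)%:E)%E.

End posterior.

Definition posterior_mean_risk (m n : nat) (X : 'M[R]_(m, n))
    (sigma2 a b : R) (L : nat) (g0 : R -> R) : \bar R :=
  (\int[true_law X sigma2 g0]_z
     (sqnorm2 (posterior_mean X sigma2 a b L z.2 - col_of_tuple z.1))%:E)%E.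

End model.

(* Main.v *)
Require Import Defs.
From HB Require Import structures.
From mathcomp Require Import all_boot all_order all_algebra.
From mathcomp Require Import all_classical all_reals all_analysis.
From mathcomp Require Import measurable_realfun.
From mathcomp Require Import zify ring lra.

Import Order.TTheory GRing.Theory Num.Theory.
Import numFieldNormedType.Exports.

Local Open Scope classical_set_scope.
Local Open Scope ring_scope.

(** Write lambda for the least eigenvalue of X^T X, s = lambda / (4 sigma2), and
let b~(y) = (X^T X)^-1 X^T y be the least squares estimator. The posterior mean
and the true coefficients are both compared with b~.

The working prior has an explicit density pi on [a, b]^n, and it dominates the
true prior: prod_j g0(beta_j) <= M pi(beta) with
  M = (M0 (b - a))^n (n + 1)^(2^L - 1).
Indeed, on a product of dyadic cells pi is (2^L / (b - a))^n times the integral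
over the independent uniform splits v_i of a monomial
prod_i v_i^(p_i) (1 - v_i)^(q_i), with p_i + q_i <= n and sum_i (p_i + q_i) = n L.
The i-th factor integrates to p_i! q_i! / (p_i + q_i + 1)!, which is at least
1 / ((n + 1) 2^(p_i + q_i)); the powers of 2 cancel (2^L)^n and there remains
pi >= (b - a)^-n (n + 1)^-(2^L - 1) ([polya_prior_ge], [polya_prior_dominates]).

In the model with coefficients beta, whatever beta is, the exponential loss
exp (s |beta - b~(Y)|^2) has expectation at most sqrt 2 ^ n
([gaussian_expR_sqnorm2_le], [integral_lsq_loss_le]): b~(Y) - beta is
the image of the noise by (X^T X)^-1 X^T, the exponential of its squared norm is a
Gaussian average of exponentials of linear forms, and Tonelli's theorem reduces
the computation to one-dimensional Gaussian integrals. That it is the exponent n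
and not m which appears comes from linearizing in R^n.

Under the true law, the posterior expectation of this loss has expectation at most
M sqrt 2 ^ n ([integral_true_law_posterior_loss_le]): replacing the true prior by
M pi costs a factor M, and in the working model the posterior expectation of the
loss has the same mean as the loss itself.

Finally x <= c - 1 + e^-c e^x turns exponential losses into quadratic
ones. By Jensen's inequality, s |posterior mean - b~|^2 and s |beta_0 - b~|^2
have true expectations at most c, for every c >= 1 with e^c >= M sqrt 2 ^ n (M0 is
taken large enough for M to be at least 1). So the risk is at most
4 c / s = 16 sigma2 c / lambda ([posterior_mean_risk_le]). As log M is at most
of order n + 2^L log (n + 1), c can be taken of that order, and the hypothesis on the
rate gives the convergence.

That lambda, defined as an infimum of eigenvalues, satisfies
lambda |w|^2 <= |X w|^2 is the variational characterization of the least
eigenvalue, proved in [lambda_minP]. *)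

Set Implicit Arguments.
Unset Strict Implicit.
Unset Printing Implicit Defensive.

(** * Integration *)

Section integration.
Context d (T : measurableType d) (R : realType).
Local Open Scope ereal_scope.

Import HBNNSimple.

(** The integral of a nonnegative function is a supremum over the simple functions
below it, so that it is monotone on all nonnegative functions, measurable or not.
It will be applied to the loss of the posterior mean. *)
Lemma ge0_le_integral_any (mu : {measure set T -> \bar R}) (f g : T -> \bar R) :
  (forall x, 0 <= f x) -> (forall x, f x <= g x) ->
  \int[mu]_x f x <= \int[mu]_x g x.
Proof.
move=> f0 fg; have g0 x : 0 <= g x by exact: le_trans (fg x).
rewrite !ge0_integralTE//; apply: ereal_sup_le => _ [h /= hf <-].
by exists h => // x; exact: le_trans (fg x).
Qed.

(** Tonelli's theorem, one coordinate at a time. *)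
Lemma integral_tuple_measure_prod (mu : {sigma_finite_measure set T -> \bar R})
    n (f : 'I_n -> T -> R) :
  (forall i, measurable_fun setT (f i)) -> (forall i x, (0 <= f i x)%R) ->
  \int[tuple_measure mu n]_t (\prod_i f i (tnth t i))%:E =
  \prod_i \int[mu]_x (f i x)%:E.
Proof.
have mP k (g : 'I_k -> T -> R) : (forall i, measurable_fun setT (g i)) ->
    measurable_fun setT (fun t : k.-tuple T => \prod_i g i (tnth t i))%R.
  move=> mg; apply: measurable_prod => i _.
  exact: measurableT_comp (mg i) (measurable_tnth i).
elim: n f => [f mf _|n IH f mf f0].
  rewrite /= integral_dirac//; last by apply/measurable_EFinP; exact: (mP _ f).
  by rewrite diracT mul1e !big_ord0.
rewrite /= /cons_measure ge0_integral_pushforward//; last 3 first.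
  - exact: measurable_tuple_cons.
  - by apply/measurable_EFinP; exact: (mP _ f).
  - by move=> t _; rewrite lee_fin prodr_ge0.
rewrite preimage_setT.
pose g i := f (lift ord0 i).
have E (x : T) (t : n.-tuple T) : (\prod_(i < n.+1) f i (tnth (tuple_cons (x, t)) i) =
    f ord0 x * \prod_(i < n) g i (tnth t i))%R.
  rewrite big_ord_recl; congr (_ * _)%R.
  by apply: eq_bigr => i _; rewrite /tuple_cons tnthS.
rewrite [LHS](eq_integral (fun z => (f ord0 z.1)%:E *
    (\prod_(i < n) g i (tnth z.2 i))%:E)); last by move=> -[x t] _; rewrite /= E.
have mF : measurable_fun setT (fun t => (\prod_(i < n) g i (tnth t i))%:E).
  by apply/measurable_EFinP; apply: (mP _ g) => i; exact: mf.
have F0 (t : n.-tuple T) : 0 <= (\prod_(i < n) g i (tnth t i))%:E.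
  by rewrite lee_fin prodr_ge0// => i _; exact: f0.
rewrite fubini_tonelli1; last 2 first.
- apply: emeasurable_funM; last exact: (measurableT_comp mF measurable_snd).
  by apply/measurable_EFinP; exact: (measurableT_comp (mf ord0) measurable_fst).
- by move=> z; rewrite mule_ge0// lee_fin.
rewrite /fubini_F/=.
under eq_integral do rewrite ge0_integralZl ?lee_fin//.
rewrite ge0_integralZr//; last 3 first.
- exact/measurable_EFinP.
- by move=> x _; rewrite lee_fin.
- by apply: integral_ge0 => t _; exact: F0.
by rewrite big_ord_recl IH// => i; [exact: mf|exact: f0].
Qed.

End integration.

Section density_law.
Context d1 d2 (T1 : measurableType d1) (T2 : measurableType d2) (R : realType).
Local Open Scope ereal_scope.

Import HBNNSimple.

(** The image by phi of the measure of density w. The measurability proofs are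
arguments so that the measure structure can be inferred. In the applications phi is
the identity: Lebesgue measure lives on a copy of R whose measurable structure is
generated by intervals, and phi transports measures from there to R itself. *)
Definition density_law (mu : {measure set T1 -> \bar R}) (w : T1 -> R)
    (phi : T1 -> T2) (_ : measurable_fun setT w) (_ : forall x, (0 <= w x)%R)
    (_ : measurable_fun setT phi) : set T2 -> \bar R :=
  fun A => \int[mu]_(x in phi @^-1` A) (w x)%:E.

Variables (mu : {measure set T1 -> \bar R}) (w : T1 -> R) (phi : T1 -> T2).
Hypotheses (mw : measurable_fun setT w) (w0 : forall x, (0 <= w x)%R).
Hypothesis mphi : measurable_fun setT phi.

Let nu := @density_law mu w phi mw w0 mphi.

Let nu0 : nu set0 = 0.
Proof. by rewrite /nu /density_law preimage_set0 integral_set0. Qed.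

Let nu_ge0 A : 0 <= nu A.
Proof. by apply: integral_ge0 => x _; rewrite lee_fin. Qed.

Let mpre A : measurable A -> measurable (phi @^-1` A).
Proof. by move=> mA; rewrite -[X in measurable X]setTI; exact: mphi. Qed.

Let nu_sigma_additive : semi_sigma_additive nu.
Proof.
move=> F mF tF mUF; apply: cvg_toP.
  apply: ereal_nondecreasing_is_cvgn => m n mn.
  by apply: lee_sum_nneg_natr => // k _ _; exact: nu_ge0.
rewrite /nu /density_law preimage_bigcup ge0_integral_bigcup//.
- by move=> i; exact: mpre.
- by apply/measurable_EFinP; exact: measurable_funTS.
- by move=> x _; rewrite lee_fin.
- apply/trivIsetP => /= i j _ _ ij; rewrite -preimage_setI.
  by move/trivIsetP : tF => /(_ _ _ _ _ ij) ->//; rewrite preimage_set0.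
Qed.

HB.instance Definition _ := isMeasure.Build _ _ _ (@density_law mu w phi mw w0 mphi)
  nu0 nu_ge0 nu_sigma_additive.

Let integral_density_nnsfun (h : {nnsfun T2 >-> R}) :
  \int[@density_law mu w phi mw w0 mphi]_x (h x)%:E =
  \int[mu]_x ((h (phi x))%:E * (w x)%:E).
Proof.
under [LHS]eq_integral do rewrite fimfunE -fsumEFin//.
rewrite [LHS]ge0_integral_fsum//; last 2 first.
  - by move=> r; exact/measurable_EFinP/measurableT_comp.
  - by move=> n x _; rewrite EFinM nnfun_muleindic_ge0.
under [RHS]eq_integral.
  move=> x _; rewrite fimfunE -fsumEFin// ge0_mule_fsuml; last first.
    by move=> r; rewrite EFinM nnfun_muleindic_ge0.
  over.
have mi r : measurable_fun setT (fun x => \1_(h @^-1` [set r]) (phi x) : R).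
  have mh : measurable_fun setT (\1_(h @^-1` [set r]) : T2 -> R) by [].
  exact: (measurableT_comp mh mphi).
rewrite [RHS]ge0_integral_fsum//; last 2 first.
  - by move=> r; apply/measurable_EFinP; apply: measurable_funM => //;
       exact: measurable_funM.
  - move=> r x _; apply: mule_ge0; last by rewrite lee_fin.
    by rewrite EFinM nnfun_muleindic_ge0.
apply: eq_fsbigr => r _.
rewrite integralZl_indic_nnsfun// integral_indic// setIT.
under [RHS]eq_integral do rewrite EFinM -muleA.
have [rlt0|r0] := ltP r 0%R.
  rewrite preimage_nnfun0// measure0 mule0.
  by under eq_integral do rewrite indic0 mul0e mule0; rewrite integral0.
rewrite ge0_integralZl//; last 2 first.
  - by apply/measurable_EFinP; exact: measurable_funM.
  - by move=> x _; rewrite mule_ge0// lee_fin.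
rewrite /= /density_law integral_mkcond; congr (_ * _).
apply: eq_integral => x _; rewrite patchE indicE.
rewrite (_ : (phi x \in _) = (x \in phi @^-1` (h @^-1` [set r]))); last first.
  by apply/idP/idP; rewrite !inE.
by case: (x \in _); rewrite ?mul1e ?mul0e.
Qed.

(** True for simple functions, hence in general by monotone convergence. *)
Lemma integral_density_law (f : T2 -> \bar R) : measurable_fun setT f ->
  (forall x, 0 <= f x) ->
  \int[@density_law mu w phi mw w0 mphi]_x f x =
  \int[mu]_x (f (phi x) * (w x)%:E).
Proof.
move=> mf f0; pose f_ := nnsfun_approx measurableT mf.
have cvgf x : (f_ n x)%:E @[n --> \oo] --> f x by exact: cvg_nnsfun_approx.
transitivity (limn (fun n => \int[@density_law mu w phi mw w0 mphi]_x (f_ n x)%:E)).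
  rewrite -monotone_convergence//=.
  - by apply: eq_integral => x _; exact/esym/cvg_lim.
  - by move=> n; exact/measurable_EFinP.
  - by move=> n x _; rewrite lee_fin.
  - by move=> x _ a b ab; rewrite lee_fin//; exact/lefP/nd_nnsfun_approx.
under eq_fun do rewrite integral_density_nnsfun.
rewrite -monotone_convergence//=.
- apply: eq_integral => x _; apply/cvg_lim => //.
  exact: cvgeZr.
- move=> n; apply/measurable_EFinP; apply: measurable_funM => //.
  exact: (measurableT_comp (measurable_funPT (f_ n)) mphi).
- by move=> n x _; rewrite mule_ge0// lee_fin.
- move=> x _ a b ab; rewrite lee_wpmul2r ?lee_fin//.
  exact/lefP/nd_nnsfun_approx.
Qed.

End density_law.

(** * The least eigenvalue of a Gram matrix *)

Section quadratic_forms.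
Context {R : realType}.

Definition bilin n (B : 'M[R]_n) (u w : 'cV[R]_n) : R := (u^T *m B *m w) 0 0.

Definition psd n (B : 'M[R]_n) := forall w, 0 <= bilin B w w.

Lemma sqnorm2E n (w : 'cV[R]_n) : sqnorm2 w = (w^T *m w) 0 0.
Proof. by rewrite mxE; apply: eq_bigr => i _; rewrite mxE expr2. Qed.

Lemma sqnorm2_ge0 n (w : 'cV[R]_n) : 0 <= sqnorm2 w.
Proof. by apply: sumr_ge0 => i _; exact: sqr_ge0. Qed.

Lemma sqnorm2_eq0 n (w : 'cV[R]_n) : (sqnorm2 w == 0) = (w == 0).
Proof.
rewrite psumr_eq0; last by move=> i _; exact: sqr_ge0.
apply/allP/eqP => [h|-> i _]; last by rewrite /= mxE expr0n/=.
by apply/colP => i; have := h i (mem_index_enum i); rewrite sqrf_eq0 mxE => /eqP.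
Qed.

Lemma sqnorm2_gt0 n (w : 'cV[R]_n) : (0 < sqnorm2 w) = (w != 0).
Proof. by rewrite lt_neqAle sqnorm2_ge0 andbT eq_sym sqnorm2_eq0. Qed.

Lemma sqnorm2Z n (a : R) (w : 'cV[R]_n) : sqnorm2 (a *: w) = a ^+ 2 * sqnorm2 w.
Proof. by rewrite mulr_sumr; apply: eq_bigr => i _; rewrite mxE exprMn. Qed.

Lemma sqnorm2_mulmx m n (X : 'M[R]_(m, n)) w :
  sqnorm2 (X *m w) = bilin (X^T *m X) w w.
Proof. by rewrite sqnorm2E trmx_mul /bilin !mulmxA. Qed.

Lemma psd_gram m n (X : 'M[R]_(m, n)) : psd (X^T *m X).
Proof. by move=> w; rewrite -sqnorm2_mulmx sqnorm2_ge0. Qed.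

Lemma sym_gram m n (X : 'M[R]_(m, n)) : (X^T *m X)^T = X^T *m X.
Proof. by rewrite trmx_mul trmxK. Qed.

Lemma bilinC n (B : 'M[R]_n) u w : B^T = B -> bilin B u w = bilin B w u.
Proof.
move=> sB; rewrite /bilin -[in LHS](trmxK (u^T *m B *m w)) [in LHS]mxE.
by rewrite !trmx_mul trmxK sB mulmxA.
Qed.

Lemma bilinDZ n (B : 'M[R]_n) u w t : B^T = B ->
  bilin B (u + t *: w) (u + t *: w) =
  bilin B u u + 2 * t * bilin B u w + t ^+ 2 * bilin B w w.
Proof.
move=> sB; rewrite /bilin [(u + _)^T]linearD/= [(t *: w)^T]linearZ/=.
rewrite !mulmxDl !mulmxDr -!scalemxAl -!scalemxAr.
have addE (M N : 'M[R]_1) : (M + N) 0 0 = M 0 0 + N 0 0 by rewrite mxE.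
have scaleE a (M : 'M[R]_1) : (a *: M) 0 0 = a * M 0 0 by rewrite mxE.
rewrite !(addE, scaleE) -!/(bilin B _ _) (bilinC w u sB).
by ring.
Qed.

(** Cauchy-Schwarz: u + t w has a nonnegative square for all t. *)
Lemma bilin_sqr_le n (B : 'M[R]_n) u w : B^T = B -> psd B ->
  bilin B u w ^+ 2 <= bilin B u u * bilin B w w.
Proof.
move=> sB pB; set p := bilin B u u; set b := bilin B u w; set c := bilin B w w.
have H t : 0 <= p + 2 * t * b + t ^+ 2 * c by rewrite -bilinDZ.
have p0 : 0 <= p by exact: pB.
have [c0|c0] := eqVneq c 0.
  rewrite c0 mulr0; have [->|b0] := eqVneq b 0; first by rewrite expr0n.
  (* the polynomial in t is affine, with value -1 at this t *)
  have := H (- (p + 1) / (2 * b)); rewrite c0 mulr0 addr0.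
  have -> : p + 2 * (- (p + 1) / (2 * b)) * b = - 1 by field.
  by rewrite ler0N1.
have cp : 0 < c by rewrite lt_neqAle eq_sym c0 pB.
(* the minimum of the polynomial in t *)
have := H (- b / c); rewrite -(pmulr_lge0 _ cp).
have -> : (p + 2 * (- b / c) * b + (- b / c) ^+ 2 * c) * c = p * c - b ^+ 2.
  by field.
by rewrite subr_ge0.
Qed.

Lemma bilin_le_sqnorm2 n (B : 'M[R]_n) :
  exists2 C : R, 0 < C & forall w, bilin B w w <= C * sqnorm2 w.
Proof.
exists (1 + \sum_j \sum_i `|B i j|) => [|w].
  by rewrite ltr_pwDl// sumr_ge0// => i _; rewrite sumr_ge0.
rewrite mulrDl mul1r ler_wpDl ?sqnorm2_ge0//.
rewrite /bilin mxE mulr_suml; apply: ler_sum => j _.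
rewrite mxE !mulr_suml; apply: ler_sum => i _; rewrite mxE.
have wi k : w k 0 ^+ 2 <= sqnorm2 w.
  by rewrite /sqnorm2 (bigD1 k)//= lerDl sumr_ge0// => l _; exact: sqr_ge0.
have ww : `|w i 0 * w j 0| <= sqnorm2 w.
  have := wi i; have := wi j; have := sqr_ge0 (`|w i 0| - `|w j 0|).
  by rewrite normrM sqrrB !real_normK ?num_real//; nra.
rewrite mulrAC mulrC (le_trans (ler_norm _))// normrM.
by rewrite ler_wpM2l.
Qed.

(** Cauchy-Schwarz for the form B, applied to B w and w, gives
|B w|^2 <= C (w^T B w); and |w| is at most a multiple of |B w|. *)
Lemma psd_unit_coercive n (B : 'M[R]_n) : B^T = B -> psd B -> B \in unitmx ->
  exists2 c : R, 0 < c & forall w, c * sqnorm2 w <= bilin B w w.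
Proof.
move=> sB pB uB.
have [C C0 HC] := bilin_le_sqnorm2 B.
have [D D0 HD] := bilin_le_sqnorm2 ((invmx B)^T *m invmx B).
exists (C * D)^-1 => [|w]; first by rewrite invr_gt0 mulr_gt0.
rewrite ler_pdivrMl ?mulr_gt0//.
have H : sqnorm2 (B *m w) <= C * bilin B w w.
  have [e0|e0] := eqVneq (sqnorm2 (B *m w)) 0.
    by rewrite e0 mulr_ge0// ?ltW.
  have ep : 0 < sqnorm2 (B *m w) by rewrite lt_neqAle eq_sym e0 sqnorm2_ge0.
  have := bilin_sqr_le (B *m w) w sB pB.
  have -> : bilin B (B *m w) w = sqnorm2 (B *m w) by rewrite sqnorm2E /bilin -mulmxA.
  rewrite expr2 => h; rewrite -(ler_pM2l ep); apply: (le_trans h).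
  by rewrite mulrA [_ * C]mulrC ler_wpM2r// HC.
have := HD (B *m w); rewrite -sqnorm2_mulmx mulmxA mulVmx// mul1mx => h.
by apply: (le_trans h); rewrite [C * D]mulrC -mulrA ler_wpM2l// ltW.
Qed.

(** Let mu be the infimum of w^T A w over the unit sphere. The form A - mu is
nonnegative and has infimum 0 on the sphere; if it were invertible it would be
bounded below there by a positive constant. So mu is an eigenvalue, and the
existence of a minimizer is a consequence instead of a prerequisite. *)
Lemma rayleigh_eigenvalue n (A : 'M[R]_n.+1) : A^T = A -> psd A ->
  exists2 mu, eigenvalue A mu & forall w, mu * sqnorm2 w <= bilin A w w.
Proof.
move=> sA pA; pose S := [set bilin A w w | w in [set w | sqnorm2 w = 1]].
have S0 : S !=set0.
  exists (bilin A (delta_mx 0 0) (delta_mx 0 0)), (delta_mx 0 0) => //=.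
  rewrite /sqnorm2 (bigD1 0)//= big1 => [|i i0].
    by rewrite mxE !eqxx expr1n addr0.
  by rewrite mxE (negPf i0) expr0n.
have lbS : has_lbound S by exists 0 => _ [w _ <-]; exact: pA.
have muP w : inf S * sqnorm2 w <= bilin A w w.
  have [->|w0] := eqVneq w 0.
    by rewrite /bilin mulmx0 mxE (eqP (_ : sqnorm2 0 == 0)) ?sqnorm2_eq0// mulr0.
  have nw : 0 < sqnorm2 w by rewrite sqnorm2_gt0.
  pose a := (Num.sqrt (sqnorm2 w))^-1.
  have a2 : a ^+ 2 = (sqnorm2 w)^-1 by rewrite exprVn sqr_sqrtr// ltW.
  rewrite -ler_pdivlMr//; apply: ge_inf => //; exists (a *: w).
    by rewrite /= sqnorm2Z a2 mulVf// gt_eqF.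
  rewrite /bilin -scalemxAr [(a *: w)^T]linearZ/= -!scalemxAl scalerA mxE -expr2 a2.
  by rewrite mulrC.
exists (inf S) => //.
pose B := A - (inf S)%:M.
have BE w : bilin B w w = bilin A w w - inf S * sqnorm2 w.
  rewrite sqnorm2E /bilin /B mulmxBr mulmxBl mul_mx_scalar -scalemxAl.
  by rewrite mxE; congr (_ + _); rewrite mxE; congr (- _); rewrite mxE.
have sB : B^T = B by rewrite /B linearB/= sA tr_scalar_mx.
have pB : psd B by move=> w; rewrite BE subr_ge0.
rewrite /eigenvalue /eigenspace -/B kermx_eq0 row_free_unit.
apply/negP => uB; have [c c0 hc] := psd_unit_coercive sB pB uB.
suff : inf S + c <= inf S by rewrite gerDl leNgt c0.
apply: lb_le_inf => // _ [w /= w1 <-].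
by have := hc w; rewrite BE w1 !mulr1 lerBrDl.
Qed.

(** An eigenvector of unit length shows that no eigenvalue is below the infimum of
the Rayleigh quotient. *)
Lemma lambda_minP n (A : 'M[R]_n.+1) : A^T = A -> psd A ->
  eigenvalue A (lambda_min A) /\
  forall w, lambda_min A * sqnorm2 w <= bilin A w w.
Proof.
move=> sA pA; have [mu emu hmu] := rayleigh_eigenvalue sA pA.
suff -> : lambda_min A = mu by [].
have lb : lbound [set x | eigenvalue A x] mu.
  move=> x /eigenvalueP[v vA v0].
  have := hmu v^T; rewrite /bilin trmxK vA -scalemxAl mxE sqnorm2E trmxK.
  have : 0 < sqnorm2 v^T by rewrite sqnorm2_gt0 -(inj_eq trmx_inj) trmxK trmx0.
  by rewrite sqnorm2E trmxK => h; rewrite ler_pM2r.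
apply/eqP; rewrite eq_le; apply/andP; split.
  by apply: ge_inf => //; exists mu.
by apply: lb_le_inf => //; exists mu.
Qed.

Lemma lambda_min_gram_gt0 m n (X : 'M[R]_(m, n)) : (0 < n)%N -> \rank X = n ->
  0 < lambda_min (X^T *m X).
Proof.
case: n X => // n X _ rX.
have [/eigenvalueP[v vA v0] h] := lambda_minP (sym_gram X) (psd_gram X).
have nv : 0 < sqnorm2 v^T by rewrite sqnorm2_gt0 -(inj_eq trmx_inj) trmxK trmx0.
have E : lambda_min (X^T *m X) * sqnorm2 v^T = sqnorm2 (X *m v^T).
  by rewrite sqnorm2_mulmx /bilin trmxK vA -scalemxAl mxE sqnorm2E trmxK.
rewrite -(pmulr_lgt0 _ nv) E sqnorm2_gt0.
apply: contra v0 => /eqP /(congr1 trmx); rewrite trmx_mul trmxK trmx0 => vX.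
have fX : row_free X^T by rewrite /row_free mxrank_tr rX.
by rewrite -(mulmx_free_eq0 v fX) vX.
Qed.

Lemma lambda_min_gram_le m n (X : 'M[R]_(m, n)) w :
  lambda_min (X^T *m X) * sqnorm2 w <= sqnorm2 (X *m w).
Proof.
case: n X w => [|n] X w.
  by rewrite {1}/sqnorm2 big_ord0 mulr0 sqnorm2_ge0.
by rewrite sqnorm2_mulmx; exact: (lambda_minP (sym_gram X) (psd_gram X)).2.
Qed.

Lemma gram_unit m n (X : 'M[R]_(m, n)) : \rank X = n -> X^T *m X \in unitmx.
Proof.
case: n X => [|n] X rX; first by rewrite unitmxE det_mx00 unitr1.
rewrite -row_free_unit -kermx_eq0; apply/rowV0P => v /sub_kermxP vX.
have := lambda_min_gram_le X v^T; rewrite sqnorm2_mulmx /bilin trmxK vX mul0mx mxE.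
rewrite pmulr_rle0 ?lambda_min_gram_gt0// => h; apply: trmx_inj; rewrite trmx0.
by apply/eqP; rewrite -sqnorm2_eq0 eq_le h sqnorm2_ge0.
Qed.

(** The transpose of the least squares operator (X^T X)^-1 X^T. *)
Definition lsq_mx m n (X : 'M[R]_(m, n)) : 'M[R]_(m, n) := X *m invmx (X^T *m X).

Lemma lsq_mxK m n (X : 'M[R]_(m, n)) : \rank X = n -> (lsq_mx X)^T *m X = 1%:M.
Proof.
by move=> /gram_unit uX; rewrite /lsq_mx trmx_mul trmx_inv sym_gram -mulmxA mulVmx.
Qed.

(** With w = (X^T X)^-1 z, the vector bounded here is X w, and |X w|^2 = w^T z.
So |X w|^4 <= |w|^2 |z|^2, while lambda |w|^2 <= |X w|^2. *)
Lemma sqnorm2_lsq_mx_le m n (X : 'M[R]_(m, n)) z : \rank X = n ->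
  lambda_min (X^T *m X) * sqnorm2 (lsq_mx X *m z) <= sqnorm2 z.
Proof.
move=> rX; have uX := gram_unit rX.
pose w := invmx (X^T *m X) *m z.
have -> : lsq_mx X *m z = X *m w by rewrite /w mulmxA.
have E : sqnorm2 (X *m w) = bilin 1%:M w z.
  by rewrite sqnorm2_mulmx /bilin mulmx1 -mulmxA /w [X in _ *m X]mulmxA mulmxV// mul1mx.
have N (u : 'cV[R]_n) : bilin 1%:M u u = sqnorm2 u by rewrite sqnorm2E /bilin mulmx1.
have CS : sqnorm2 (X *m w) ^+ 2 <= sqnorm2 w * sqnorm2 z.
  rewrite E -!N; apply: bilin_sqr_le; first exact: trmx1.
  by move=> u; rewrite N sqnorm2_ge0.
have [e0|e0] := eqVneq (sqnorm2 (X *m w)) 0.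
  by rewrite e0 mulr0 sqnorm2_ge0.
have ep : 0 < sqnorm2 (X *m w) by rewrite lt_neqAle eq_sym e0 sqnorm2_ge0.
rewrite -(ler_pM2r ep) -mulrA -expr2.
case: n X z rX uX w E N CS e0 ep => [|n] X z rX uX w E N CS e0 ep.
  by case/eqP: e0; apply/eqP; rewrite sqnorm2_eq0 (flatmx0 w) mulmx0.
have l0 := lambda_min_gram_gt0 (ltn0Sn n) rX.
rewrite (le_trans (ler_wpM2l (ltW l0) CS))// mulrA mulrC.
by rewrite ler_wpM2l ?sqnorm2_ge0// lambda_min_gram_le.
Qed.

Lemma sqnorm2B_le k (u v w : 'cV[R]_k) :
  sqnorm2 (u - w) <= 2 * (sqnorm2 (u - v) + sqnorm2 (w - v)).
Proof.
rewrite -big_split/= mulr_sumr; apply: ler_sum => i _; rewrite !mxE.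
by have := sqr_ge0 (u i ord0 - v i ord0 + (w i ord0 - v i ord0)); nra.
Qed.

End quadratic_forms.

(** * Exponential moments of Gaussian noise *)

Section gaussian_moments.
Context {R : realType}.
Local Notation leb := (@lebesgue_measure R).

(** Completing the square: the tilted density is a multiple of the normal density
of mean theta + a s^2. *)
Lemma integral_normal_expR (theta s a : R) : 0 < s ->
  (\int[leb]_x (normal_pdf theta s x * expR (a * (x - theta)))%:E
   = (expR (a ^+ 2 * s ^+ 2 / 2))%:E)%E.
Proof.
move=> s0; have sn0 : s != 0 by rewrite gt_eqF.
transitivity (\int[leb]_x ((expR (a ^+ 2 * s ^+ 2 / 2))%:E *
    (normal_pdf (theta + a * s ^+ 2) s x)%:E))%E.
  apply: eq_integral => x _; rewrite -EFinM !normal_pdfE//= /normal_fun; congr EFin.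
  rewrite mulrCA -[LHS]mulrA -!expRD; congr (_ * expR _).
  by rewrite -(mulr_natr (s ^+ 2)); field.
rewrite ge0_integralZl//.
- by rewrite integral_normal_pdf mule1.
- by apply/measurable_EFinP; exact: measurable_normal_pdf.
- by move=> x _; rewrite lee_fin normal_pdf_ge0.
Qed.

(** The factor e^(x^2 / 4) turns the variance 1 into 2. *)
Lemma integral_normal_expR_sqr :
  (\int[leb]_x (normal_pdf 0 1 x * expR (x ^+ 2 / 4))%:E
   = (Num.sqrt 2)%:E)%E.
Proof.
have s20 : Num.sqrt 2 != 0 :> R by rewrite gt_eqF// sqrtr_gt0.
transitivity (\int[leb]_x ((Num.sqrt 2)%:E *
    (normal_pdf 0 (Num.sqrt 2) x)%:E))%E.
  apply: eq_integral => x _; rewrite -EFinM !normal_pdfE ?oner_eq0//= /normal_fun.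
  congr EFin.
  rewrite [RHS]mulrA -[LHS]mulrA -!expRD; congr (_ * expR _).
    rewrite /normal_peak expr1n mul1r sqr_sqrtr// -[2 * pi *+ 2]mulrnAr.
    by rewrite sqrtrM// invfM mulrA divff ?mul1r.
  by rewrite sqr_sqrtr// expr1n; field.
rewrite ge0_integralZl//.
- by rewrite integral_normal_pdf mule1.
- by apply/measurable_EFinP; exact: measurable_normal_pdf.
- by move=> x _; rewrite lee_fin normal_pdf_ge0.
Qed.

(** The vector W^T (y - theta) of R^n is a linear image of the noise. Writing
the exponential of its squared norm as an average over an auxiliary standard normal
z in R^n makes the exponent linear in the noise, whose components can then be
integrated separately; the result, e^(s sigma^2 |W z|^2), is integrated over z.
The constant 1/4 is the one of [integral_normal_expR_sqr]. *)
Lemma gaussian_expR_sqnorm2_le m n (W : 'M[R]_(m, n)) (theta : 'cV[R]_m)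
    (sigma s : R) :
  0 < sigma -> 0 <= s ->
  (forall z : 'cV[R]_n, s * sigma ^+ 2 * sqnorm2 (W *m z) <= sqnorm2 z / 4) ->
  (\int[lebesgue_tuple m]_y
     (expR (s * sqnorm2 (W^T *m (col_of_tuple y - theta)))
      * \prod_i normal_pdf (theta i ord0) sigma (tnth y i))%:E
   <= (Num.sqrt 2 ^+ n)%:E)%E.
Proof.
move=> sigma0 s0 HW.
pose t := Num.sqrt (2 * s).
have t2 : t ^+ 2 = 2 * s by rewrite sqr_sqrtr// mulr_ge0.
pose u (y : m.-tuple R) (j : 'I_n) := (W^T *m (col_of_tuple y - theta)) j ord0.
pose phi (y : m.-tuple R) := \prod_i normal_pdf (theta i ord0) sigma (tnth y i).
pose psi (z : n.-tuple R) := \prod_j normal_pdf 0 1 (tnth z j).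
have phi0 y : 0 <= phi y by apply: prodr_ge0 => i _; exact: normal_pdf_ge0.
have psi0 z : 0 <= psi z by apply: prodr_ge0 => i _; exact: normal_pdf_ge0.
pose H (yz : m.-tuple R * n.-tuple R) : R :=
  phi yz.1 * psi yz.2 * expR (t * \sum_j u yz.1 j * tnth yz.2 j).
have H0 yz : 0 <= H yz by rewrite !mulr_ge0// expR_ge0.
have mH : measurable_fun setT H.
  apply: measurable_funM; first apply: measurable_funM.
  - apply: measurable_prod => i _.
    apply: (measurableT_comp (measurable_normal_pdf _ _)).
    exact: (measurableT_comp (measurable_tnth i)).
  - apply: measurable_prod => i _.
    apply: (measurableT_comp (measurable_normal_pdf _ _)).
    exact: (measurableT_comp (measurable_tnth i)).
  - apply: measurableT_comp => //; apply: measurable_funM => //.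
    apply: measurable_sum => j; apply: measurable_funM; last first.
      exact: (measurableT_comp (measurable_tnth j)).
    rewrite /u; under eq_fun do rewrite mxE.
    apply: measurable_sum => i; apply: measurable_funM => //.
    under eq_fun do rewrite !mxE.
    apply: measurable_funB => //.
    exact: (measurableT_comp (measurable_tnth i)).
(* linearization of the square: e^(s u^2) is the moment generating function at
   sqrt (2 s) u of a standard normal variable *)
have hubbard y : (\int[lebesgue_tuple n]_z (H (y, z))%:E =
    (expR (s * sqnorm2 (W^T *m (col_of_tuple y - theta))) * phi y)%:E)%E.
  pose f (j : 'I_n) (x : R) := normal_pdf 0 1 x * expR (t * u y j * (x - 0)).
  have mf j : measurable_fun setT (f j).
    apply: measurable_funM; first exact: measurable_normal_pdf.
    by apply: measurableT_comp => //; apply: measurable_funM => //; exact: measurable_funB.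
  have f0 j x : 0 <= f j x by rewrite mulr_ge0 ?normal_pdf_ge0 ?expR_ge0.
  transitivity (\int[lebesgue_tuple n]_z ((phi y)%:E * (\prod_j f j (tnth z j))%:E))%E.
    apply: eq_integral => z _; rewrite -EFinM /H/= -mulrA big_split/= -expR_sum.
    congr (_ * (_ * expR _))%:E.
    by rewrite mulr_sumr; apply: eq_bigr => j _; rewrite subr0 mulrA.
  rewrite ge0_integralZl//; last 3 first.
  - apply/measurable_EFinP; apply: measurable_prod => j _.
    exact: (measurableT_comp (mf j) (measurable_tnth j)).
  - by move=> z _; rewrite lee_fin prodr_ge0.
  - by rewrite lee_fin.
  rewrite integral_tuple_measure_prod//.
  rewrite (eq_bigr (fun j => (expR (s * u y j ^+ 2))%:E)) => [|j _].
    by rewrite prodEFin -EFinM mulrC -expR_sum -mulr_sumr.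
  rewrite integral_normal_expR//; congr (expR _)%:E.
  by rewrite exprMn t2; field.
apply: (@le_trans _ _ (\int[lebesgue_tuple m]_y \int[lebesgue_tuple n]_z (H (y, z))%:E)%E).
  apply: ge0_le_integral_any => y; last by rewrite hubbard lexx.
  by rewrite lee_fin mulr_ge0 ?expR_ge0//; exact: phi0.
rewrite (fubini_tonelli (m1 := lebesgue_tuple m) (m2 := lebesgue_tuple n)
  (EFin \o H))/=; last 2 first.
- exact/measurable_EFinP.
- by move=> yz; rewrite lee_fin.
have inner z : (\int[lebesgue_tuple m]_y (H (y, z))%:E =
    (psi z * expR (s * sigma ^+ 2 * sqnorm2 (W *m col_of_tuple z)))%:E)%E.
  pose w i := (W *m col_of_tuple z) i ord0.
  pose f (i : 'I_m) (x : R) := normal_pdf (theta i ord0) sigma x *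
    expR (t * w i * (x - theta i ord0)).
  have mf i : measurable_fun setT (f i).
    apply: measurable_funM; first exact: measurable_normal_pdf.
    by apply: measurableT_comp => //; apply: measurable_funM => //; exact: measurable_funB.
  have f0 i x : 0 <= f i x by rewrite mulr_ge0 ?normal_pdf_ge0 ?expR_ge0.
  transitivity (\int[lebesgue_tuple m]_y ((psi z)%:E * (\prod_i f i (tnth y i))%:E))%E.
    apply: eq_integral => y _; rewrite -EFinM /H/= mulrAC mulrC big_split/= -expR_sum.
    congr (_ * (_ * expR _))%:E.
    rewrite mulr_sumr.
    under eq_bigr do rewrite /u mxE mulr_suml mulr_sumr.
    rewrite exchange_big/=; apply: eq_bigr => i _.
    rewrite [w i]mxE mulr_sumr mulr_suml; apply: eq_bigr => j _; rewrite !mxE.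
    by ring.
  rewrite ge0_integralZl//; last 3 first.
  - apply/measurable_EFinP; apply: measurable_prod => i _.
    exact: (measurableT_comp (mf i) (measurable_tnth i)).
  - by move=> y _; rewrite lee_fin prodr_ge0.
  - by rewrite lee_fin.
  rewrite integral_tuple_measure_prod//.
  rewrite (eq_bigr (fun i => (expR (s * sigma ^+ 2 * w i ^+ 2))%:E)) => [|i _].
    by rewrite prodEFin -EFinM -expR_sum -mulr_sumr.
  rewrite integral_normal_expR//; congr (expR _)%:E.
  by rewrite exprMn t2; field.
pose f (j : 'I_n) (x : R) := normal_pdf 0 1 x * expR (x ^+ 2 / 4).
have mf j : measurable_fun setT (f j).
  apply: measurable_funM; first exact: measurable_normal_pdf.
  by apply: measurableT_comp => //; apply: measurable_funM.
have f0 j x : 0 <= f j x by rewrite mulr_ge0 ?normal_pdf_ge0 ?expR_ge0.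
apply: (@le_trans _ _ (\int[lebesgue_tuple n]_z (\prod_j f j (tnth z j))%:E)%E).
  apply: ge0_le_integral_any => z; rewrite /= inner lee_fin.
    by rewrite mulr_ge0 ?expR_ge0.
  rewrite big_split/= ler_wpM2l// -expR_sum ler_expR -mulr_suml.
  rewrite (le_trans (HW _))// ler_pM2r//.
  by apply: ler_sum => j _; rewrite mxE.
rewrite integral_tuple_measure_prod//.
rewrite (eq_bigr (fun j => (Num.sqrt 2)%:E)) => [|j _].
  by rewrite prodEFin prodr_const card_ord.
exact: integral_normal_expR_sqr.
Qed.

End gaussian_moments.

(** * Dyadic cells and the masses of a Polya tree *)

Section dyadic_partition.
Context {R : realType}.
Variables (a b : R).
Hypothesis ab : a < b.

Let ba0 : 0 < b - a. Proof. by rewrite subr_gt0. Qed.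

Let pow2_gt0 l : 0 < (2 ^ l)%:R :> R.
Proof. by rewrite ltr0n expn_gt0. Qed.

Lemma measurable_dyadic l k : measurable (dyadic a b l k).
Proof. by rewrite /dyadic; case: ifP => _; exact: measurable_itv. Qed.

Lemma dyadic_sub l k : (k < 2 ^ l)%N -> dyadic a b l k `<=` `[a, b].
Proof.
move=> kl x; rewrite /dyadic /=.
have kR : k.+1%:R <= (2 ^ l)%:R :> R by rewrite ler_nat.
case: ifP => _; rewrite /= !in_itv/= => /andP[h1 h2].
  rewrite h2 andbT (le_trans _ h1)// lerBrDr -lerBrDl ler_pdivrMr//.
  by rewrite -[leLHS]mulr1 ler_pM2l// ler1n expn_gt0.
apply/andP; split.
  by rewrite (le_trans _ h1)// lerDl divr_ge0 ?mulr_ge0// ltW.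
rewrite (le_trans (ltW h2))// addrC -lerBrDr ler_pdivrMr//.
by rewrite ler_pM2l.
Qed.

Lemma dyadic_cover l x : x \in `[a, b] -> exists k : 'I_(2 ^ l), x \in dyadic a b l k.
Proof.
rewrite in_itv/= => /andP[ax xb].
pose u := (x - a) * (2 ^ l)%:R / (b - a).
have u0 : 0 <= u by rewrite divr_ge0 ?mulr_ge0 ?subr_ge0// ltW.
have xE : x = a + (b - a) * u / (2 ^ l)%:R.
  by rewrite /u; field; rewrite !gt_eqF.
have ul : u <= (2 ^ l)%:R.
  by rewrite ler_pdivrMr// mulrC ler_pM2l// lerB.
have [ux|ux] := ltP u ((2 ^ l).-1)%:R.
  have /andP[k1 k2] := Num.Theory.truncn_itv u0.
  have kl : (Num.truncn u < (2 ^ l).-1)%N by rewrite -(ltr_nat R) (le_lt_trans k1).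
  have kl' : (Num.truncn u < 2 ^ l)%N by rewrite (leq_trans kl)// leq_pred.
  exists (Ordinal kl'); rewrite inE /dyadic /= ltn_eqF//= in_itv/= xE.
  by rewrite lerD2l ler_pM2r ?invr_gt0// ler_pM2l// k1 ltrD2l ltr_pM2r ?invr_gt0// ltr_pM2l.
have kl : ((2 ^ l).-1 < 2 ^ l)%N by rewrite prednK ?expn_gt0.
exists (Ordinal kl); rewrite inE /dyadic /= eqxx /= in_itv/= xb andbT xE.
have -> : b - (b - a) / (2 ^ l)%:R = a + (b - a) * ((2 ^ l).-1)%:R / (2 ^ l)%:R.
  by rewrite -subn1 natrB ?expn_gt0//; field; rewrite gt_eqF.
by rewrite lerD2l ler_pM2r ?invr_gt0// ler_pM2l.
Qed.

Lemma lebesgue_dyadic l k :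
  lebesgue_measure (dyadic a b l k) = ((b - a) / (2 ^ l)%:R)%:E.
Proof.
have e0 : 0 < (b - a) / (2 ^ l)%:R by rewrite divr_gt0.
rewrite /dyadic; case: ifP => _; rewrite lebesgue_measure_itv/= lte_fin.
  by rewrite ltrBlDr ltrDl e0 -EFinB; congr EFin; ring.
rewrite ltrD2l ltr_pM2r ?invr_gt0// ltr_pM2l// ltr_nat ltnSn -EFinB; congr EFin.
by rewrite -natr1; field; rewrite gt_eqF.
Qed.

End dyadic_partition.

Section polya_mass.
Context {R : realType}.
Implicit Types (V : nat -> nat -> R).

Lemma sum_polya_mass V l : \sum_(k < 2 ^ l) polya_mass V l k = 1.
Proof.
elim: l => [|l IH]; first by rewrite expn0 big_ord1.
rewrite -IH -(big_mkord xpredT (polya_mass V l.+1)) expnS mul2n.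
rewrite -(big_mkord xpredT (polya_mass V l)).
elim: (2 ^ l)%N => [|k IHk]; first by rewrite !big_nil.
rewrite doubleS !big_nat_recr//= IHk odd_double uphalf_double doubleK -addrA/=.
by congr (_ + _); ring.
Qed.

Lemma polya_mass_ge0 V l k : (forall l k, 0 <= V l k <= 1) -> 0 <= polya_mass V l k.
Proof.
move=> V01; elim: l k => [|l IH] k //=; apply: mulr_ge0 => //.
by have /andP[? ?] := V01 l k./2; case: ifP; rewrite ?subr_ge0.
Qed.

Lemma polya_mass_le1 V l k : (forall l k, 0 <= V l k <= 1) -> polya_mass V l k <= 1.
Proof.
move=> V01; elim: l k => [|l IH] k //=.
have /andP[? ?] := V01 l k./2.
apply: mulr_ile1 => //.
- by case: ifP; rewrite ?subr_ge0.
- exact: polya_mass_ge0.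
- by case: ifP => // _; rewrite gerBl.
Qed.

(** The mass of a cell has one factor v or 1 - v for each node on the path to the
cell. So a product of masses is a monomial in the v_i and the 1 - v_i, and such
expressions factorize when the splits v_i are independent. *)
Definition monomial N (v : N.-tuple R) (p q : nat -> nat) : R :=
  \prod_(i < N) XMonemX (p i) (q i) (nth 0 v i).

Lemma monomialM N (v : N.-tuple R) p q p' q' :
  monomial v p q * monomial v p' q' =
  monomial v (fun i => p i + p' i)%N (fun i => q i + q' i)%N.
Proof.
rewrite -big_split/=; apply: eq_bigr => i _; rewrite XMonemXM.
by congr XMonemX; exact: addnC.
Qed.

Lemma monomial0 N (v : N.-tuple R) :
  monomial v (fun=> 0%N) (fun=> 0%N) = 1.
Proof. by rewrite /monomial big1// => i _; rewrite XMonemX00. Qed.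

(** The path to a cell of level l meets each level below l once, in the nodes
numbered from 0 to 2^l - 2; the vanishing of the exponents beyond these is what
makes the induction on l go through. *)
Lemma node_polya_mass_monomial L l k : (l <= L)%N -> (k < 2 ^ l)%N ->
  exists p q : nat -> nat,
    [/\ forall v : (2 ^ L).-1.-tuple R, polya_mass (node v) l k = monomial v p q,
        forall i, (p i + q i <= 1)%N,
        forall i, ((2 ^ l).-1 <= i)%N -> (p i + q i = 0)%N &
        (\sum_(i < (2 ^ L).-1) (p i + q i) = l)%N].
Proof.
elim: l k => [|l IH] k lL kl.
  exists (fun=> 0%N), (fun=> 0%N); split => // [v|].
    by rewrite monomial0.
  by rewrite big1.
have kl2 : (k./2 < 2 ^ l)%N by rewrite ltn_half_double -mul2n -expnS.
have [p [q [h1 h2 h3 h4]]] := IH _ (ltnW lL) kl2.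
(* the number of the node that splits the parent of the cell *)
pose i0 := ((2 ^ l).-1 + k./2)%N.
have lt1 : (i0 < (2 ^ l.+1).-1)%N.
  by rewrite /i0 expnS mul2n -addnn -(prednK (expn_gt0 2 l : (0 < 2 ^ l)%N)) in kl2 *; lia.
have lt2 : (i0 < (2 ^ L).-1)%N.
  by apply: (leq_trans lt1); rewrite -!subn1 leq_sub2r// leq_exp2l.
pose p' i := ((i == i0) && ~~ odd k : nat).
pose q' i := ((i == i0) && odd k : nat).
have pq i : (p' i + q' i = (i == i0))%N.
  by rewrite /p' /q'; case: (i == i0); case: (odd k).
exists (fun i => p' i + p i)%N, (fun i => q' i + q i)%N; split.
- move=> v; rewrite -monomialM -h1 /=; congr (_ * _).
  rewrite /monomial (bigD1 (Ordinal lt2))//= big1 => [|i ii0]; last first.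
    have /negbTE ii : (i : nat) != i0 by [].
    by rewrite /p' /q' ii XMonemX00.
  rewrite mulr1 /XMonemX /p' /q' eqxx/= /node -/i0.
  by case: (odd k); rewrite ?expr0 ?expr1 ?mul1r ?mulr1.
- move=> i; rewrite addnACA pq; case: eqP => [->|_]; last by rewrite add0n.
  by rewrite h3// leq_addr.
- move=> i li; rewrite addnACA pq h3 ?gtn_eqF//; first by rewrite (leq_trans lt1).
  by rewrite (leq_trans _ li)// -!subn1 leq_sub2r// leq_exp2l.
- under eq_bigr do rewrite addnACA pq.
  rewrite big_split/= h4 (bigD1 (Ordinal lt2))//= eqxx big1 => [|i ii0].
    by rewrite addn0.
  have /negbTE ii : (i : nat) != i0 by [].
  by rewrite ii.
Qed.

Lemma prod_node_polya_mass_monomial L n (k : 'I_n -> 'I_(2 ^ L)) :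
  exists p q : nat -> nat,
    [/\ forall v : (2 ^ L).-1.-tuple R,
          \prod_j polya_mass (node v) L (k j) = monomial v p q,
        forall i, (p i + q i <= n)%N &
        (\sum_(i < (2 ^ L).-1) (p i + q i) = n * L)%N].
Proof.
elim: n k => [|n IH] k.
  exists (fun=> 0%N), (fun=> 0%N); split => // [v|].
    by rewrite big_ord0 monomial0.
  by rewrite big1.
have [p [q [h1 h2 h3]]] := IH (fun j => k (lift ord0 j)).
have [p' [q' [h1' h2' _ h3']]] := node_polya_mass_monomial (leqnn L) (ltn_ord (k ord0)).
exists (fun i => p' i + p i)%N, (fun i => q' i + q i)%N; split.
- by move=> v; rewrite big_ord_recl h1 h1' monomialM.
- by move=> i; rewrite addnACA -add1n leq_add.
- under eq_bigr do rewrite addnACA.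
  by rewrite big_split/= h3 h3' mulSn.
Qed.

End polya_mass.

(** * Independent uniform splits *)

Section uniform_splits.
Context {R : realType}.
Local Notation leb := (@lebesgue_measure R).

Lemma integral_beta11 (h : R -> R) : measurable_fun setT h ->
  (forall x, 0 <= h x) ->
  (\int[beta_prob 1 1]_x (h x)%:E = \int[leb]_(x in `[0%R, 1%R]) (h x)%:E)%E.
Proof.
move=> mh h0; rewrite (eq_measure_integral (uniform_prob (@ltr01 R))); last first.
  by move=> A _ _; exact: (congr1 (fun f => f A) beta_prob_uniform).
rewrite integral_uniform; first by rewrite subr0 invr1 mul1e.
  exact/measurable_EFinP.
by move=> x; rewrite lee_fin.
Qed.

Lemma measurable_XMonemX_restrict p q :
  measurable_fun setT (@XMonemX R p q \_ `[0, 1]).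
Proof. by apply/measurable_restrict => //; rewrite setTI; exact: measurable_XMonemX. Qed.

Lemma XMonemX_restrict_ge0 p q (x : R) : 0 <= (@XMonemX R p q \_ `[0, 1]) x.
Proof. by rewrite patchE; case: ifPn => //; rewrite inE; exact: XMonemX_ge0. Qed.

Lemma beta11_moment p q :
  (\int[beta_prob 1 1]_x ((@XMonemX R p q \_ `[0, 1]) x)%:E =
   ((p`! * q`!)%:R / (p + q).+1`!%:R)%:E)%E.
Proof.
rewrite integral_beta11; last 2 first.
- exact: measurable_XMonemX_restrict.
- exact: XMonemX_restrict_ge0.
rewrite -beta_fun_fact EFin_beta_fun /= integral_XMonemX_restrict.
by rewrite [RHS]integral_XMonemX_restrict setIid setTI.
Qed.

(** The right-hand side is the inverse of (p + q + 1) times the binomial coefficient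
of p + q over p, which is at most 2^(p + q). *)
Lemma beta11_moment_ge n p q : (p + q <= n)%N ->
  (n.+1%:R * 2 ^+ (p + q))^-1 <= (p`! * q`!)%:R / (p + q).+1`!%:R :> R.
Proof.
move=> pqn.
have C2 : ('C(p + q, p) <= 2 ^ (p + q))%N.
  rewrite -[2%N]/(1 + 1)%N expnDn (bigD1 (Ordinal (leq_addr q p : p < (p + q).+1)%N))//=.
  by rewrite !exp1n !muln1 leq_addr.
have := bin_fact (leq_addr q p); rewrite addKn => E.
have P0 : (p`! * q`!)%:R != 0 :> R by rewrite pnatr_eq0 -lt0n muln_gt0 !fact_gt0.
rewrite factS -E; move: (p`! * q`!)%N P0 => P P0.
rewrite mulnA [(_ * P)%:R]natrM [X in _ <= _ / X]mulrC [X in _ <= _ * X]invfM.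
rewrite mulrA divff// mul1r.
have C0 : (0 < 'C(p + q, p))%N by rewrite bin_gt0 leq_addr.
rewrite lef_pV2 ?posrE ?mulr_gt0 ?exprn_gt0 ?ltr0n ?muln_gt0 ?C0//.
by rewrite -natrX -natrM ler_nat leq_mul.
Qed.

End uniform_splits.

Section cubes.
Context {R : realType} {n : nat}.
Variables (a b : R).

Lemma indic_cube (v : n.-tuple R) :
  \1_(cube a b) v = \prod_i \1_(`[a, b]%classic : set R) (tnth v i) :> R.
Proof.
rewrite indicE; case: (boolP (v \in cube a b)); rewrite ?inE ?notin_setE => gv.
  by rewrite big1// => i _; rewrite indicE mem_set//; exact: (gv i).
have /existsNP[i vi] := gv.
by rewrite (bigD1 i)//= indicE memNset ?mul0r.
Qed.

Lemma measurable_cube : measurable (cube a b : set (n.-tuple R)).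
Proof.
rewrite (_ : cube a b = \bigcap_i [set v | tnth v i \in `[a, b]]); last first.
  by apply/seteqP; split => v gv i => [_|]; exact: gv.
apply: fin_bigcap_measurable => // i _.
have mab : measurable (`[a, b]%classic : set R) by exact: measurable_itv.
by have := @measurable_tnth _ _ n i measurableT _ mab; rewrite setTI.
Qed.

End cubes.

Section polya_prior.
Context {R : realType}.
Variables (a b : R) (L : nat).
Hypothesis ab : a < b.
Local Notation N := (2 ^ L).-1.

Definition unit_splits : set (N.-tuple R) :=
  cube 0 1.

Lemma node_unit_splits v : unit_splits v -> forall l k, 0 <= node v l k <= 1.
Proof.
move=> gv l k; rewrite /node; set i := (_ + _)%N.
have [iN|iN] := ltnP i N; last by rewrite nth_default ?size_tuple// lexx ler01.
by have := gv (Ordinal iN); rewrite (tnth_nth 0) in_itv.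
Qed.

Lemma measurable_unit_splits : measurable unit_splits.
Proof. exact: measurable_cube. Qed.

Lemma polya_splitsT : polya_splits L [set: N.-tuple R] = 1%E.
Proof.
rewrite -[LHS]mul1e -integral_cst//.
transitivity (\int[@polya_splits R L]_v (\prod_(i < N) cst 1 (tnth v i))%:E)%E.
  by apply: eq_integral => v _; rewrite big1.
rewrite (@integral_tuple_measure_prod _ _ _ (beta_prob 1 1) _ (fun=> cst 1))//.
rewrite big1// => i _.
by rewrite -[RHS](@probability_setT _ _ _ (beta_prob 1 1)) -[RHS]mul1e -integral_cst.
Qed.

Lemma polya_splits_unit : polya_splits L unit_splits = 1%E.
Proof.
rewrite -[X in polya_splits _ X]setIT -integral_indic//; last exact: measurable_unit_splits.
transitivity (\int[@polya_splits R L]_v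
    (\prod_(i < N) \1_(`[0, 1]%classic : set R) (tnth v i))%:E)%E.
  by apply: eq_integral => v _; rewrite /unit_splits indic_cube.
rewrite (@integral_tuple_measure_prod _ _ _ (beta_prob 1 1) _
  (fun=> \1_(`[0, 1]%classic : set R)))//.
by rewrite big1// => i _; rewrite integral_indic// setIT; exact: beta_prob01.
Qed.

Lemma measurable_node l k : measurable_fun setT (fun v : N.-tuple R => node v l k).
Proof.
rewrite /node; set i := (_ + _)%N.
have [iN|iN] := ltnP i N.
  rewrite (_ : (fun _ => _) = (@tnth _ R)^~ (Ordinal iN)); first exact: measurable_tnth.
  by apply/funext => v; rewrite (tnth_nth 0).
rewrite (_ : (fun _ => _) = cst 0)//.
by apply/funext => v; rewrite nth_default// size_tuple.
Qed.

Lemma measurable_polya_mass l k :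
  measurable_fun setT (fun v : N.-tuple R => polya_mass (node v) l k).
Proof.
elim: l k => [|l IH] k //=.
apply: measurable_funM => //.
case: (odd k); last exact: measurable_node.
by apply: measurable_funB => //; exact: measurable_node.
Qed.

Variable n : nat.

(** The density of the coefficients given the splits. For splits outside [0, 1] the
masses can be negative; the indicator makes the function nonnegative everywhere
without changing its integral over the splits. *)
Definition unit_polya_lik (z : n.-tuple R * N.-tuple R) : R :=
  \1_unit_splits z.2 * \prod_j polya_density a b (node z.2) L (tnth z.1 j).

Lemma measurable_polya_lik :
  measurable_fun setT (fun z : n.-tuple R * N.-tuple R =>
    \prod_j polya_density a b (node z.2) L (tnth z.1 j)).
Proof.
apply: measurable_prod => j _; apply: measurable_sum => k.
apply: measurable_funM; last first.
  apply: measurableT_comp; first by apply: measurable_indic; exact: measurable_dyadic.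
  exact: (measurableT_comp (measurable_tnth j)).
apply: measurable_funM => //.
exact: (measurableT_comp (measurable_polya_mass L k)).
Qed.

Lemma measurable_unit_polya_lik : measurable_fun setT unit_polya_lik.
Proof.
apply: measurable_funM; last exact: measurable_polya_lik.
have mi : measurable_fun setT (\1_unit_splits : N.-tuple R -> R).
  by apply: measurable_indic; exact: measurable_unit_splits.
exact: (measurableT_comp mi measurable_snd).
Qed.

Lemma polya_density_ge0 v x : unit_splits v -> 0 <= polya_density a b (node v) L x.
Proof.
move=> gv; apply: sumr_ge0 => k _; rewrite !mulr_ge0// ?polya_mass_ge0//.
- by rewrite invr_ge0 subr_ge0 ltW.
- exact: node_unit_splits.
Qed.

Lemma unit_polya_lik_ge0 z : 0 <= unit_polya_lik z.
Proof.
rewrite /unit_polya_lik indicE; case: (boolP (z.2 \in unit_splits)); last by rewrite mul0r.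
by rewrite inE => gz; rewrite mul1r prodr_ge0// => j _; exact: polya_density_ge0.
Qed.

(** All splits are in [0, 1] almost surely. *)
Lemma polya_intE (beta : n.-tuple R) :
  polya_int a b L (fun g => (\prod_j g (tnth beta j))%:E) =
  (\int[@polya_splits R L]_v (unit_polya_lik (beta, v))%:E)%E.
Proof.
apply: ae_eq_integral => //.
- apply/measurable_EFinP.
  exact: (measurableT_comp measurable_polya_lik (pair1_measurable beta)).
- apply/measurable_EFinP.
  exact: (measurableT_comp measurable_unit_polya_lik (pair1_measurable beta)).
exists (~` unit_splits); split.
- by apply: measurableC; exact: measurable_unit_splits.
- have := polya_splitsT; rewrite -(setUv unit_splits) measureU//; last 3 first.
  + exact: measurable_unit_splits.
  + by apply: measurableC; exact: measurable_unit_splits.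
  + exact: setICr.
  rewrite [X in (X + _)%E](_ : _ = 1%E); last exact: polya_splits_unit.
  case E : (X in (_ + X)%E) => [r| |]// [r1].
  apply: etrans E _; congr EFin.
  by move: r1 => /eqP; rewrite eq_sym addrC -subr_eq subrr => /eqP.
- move=> v /= vN gv; apply: vN => _.
  by rewrite /unit_polya_lik/= indicE mem_set// mul1r.
Qed.

End polya_prior.
Arguments unit_splits {R L}.

(** * The prior density of the coefficients *)

Section polya_prior_density.
Context {R : realType}.
Variables (a b : R) (L n : nat).
Hypothesis ab : a < b.
Local Notation N := (2 ^ L).-1.
Local Notation lik := (@unit_polya_lik R a b L n).

Definition polya_prior (beta : n.-tuple R) : R :=
  fine (polya_int a b L (fun g => (\prod_j g (tnth beta j))%:E)).

(** A crude bound, for finiteness only: each of the 2^L terms is at most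
2^L / (b - a). *)
Lemma polya_density_le (v : N.-tuple R) x : unit_splits v ->
  polya_density a b (node v) L x <= (2 ^ L)%:R * ((2 ^ L)%:R / (b - a)).
Proof.
move=> gv; have c0 : 0 <= (2 ^ L)%:R / (b - a) by rewrite divr_ge0// subr_ge0 ltW.
apply: (@le_trans _ _ (\sum_(k < 2 ^ L) ((2 ^ L)%:R / (b - a)))).
  apply: ler_sum => k _; rewrite -mulrA ler_piMr// mulr_ile1//.
  - by rewrite polya_mass_ge0//; exact: node_unit_splits.
  - by rewrite polya_mass_le1//; exact: node_unit_splits.
by rewrite sumr_const card_ord [leRHS]mulr_natl.
Qed.

Lemma unit_polya_lik_le beta v :
  lik (beta, v) <= ((2 ^ L)%:R * ((2 ^ L)%:R / (b - a))) ^+ n.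
Proof.
have c0 : 0 <= (2 ^ L)%:R * ((2 ^ L)%:R / (b - a)).
  by rewrite mulr_ge0// divr_ge0// subr_ge0 ltW.
rewrite /unit_polya_lik/= indicE; case: (boolP (v \in unit_splits)); last first.
  by rewrite mul0r exprn_ge0.
rewrite inE => gv; rewrite mul1r -[n in _ ^+ n]card_ord -prodr_const.
by apply: ler_prod => j _; rewrite polya_density_ge0//= polya_density_le.
Qed.

Lemma integral_unit_polya_lik_le beta :
  (\int[@polya_splits R L]_v (lik (beta, v))%:E <=
   (((2 ^ L)%:R * ((2 ^ L)%:R / (b - a))) ^+ n)%:E)%E.
Proof.
apply: (@le_trans _ _ (\int[@polya_splits R L]_v
   (cst (((2 ^ L)%:R * ((2 ^ L)%:R / (b - a))) ^+ n)%:E v))%E).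
  apply: ge0_le_integral_any => v; rewrite lee_fin.
    exact: unit_polya_lik_ge0.
  exact: unit_polya_lik_le.
by rewrite integral_cst// [X in (_ * X)%E](_ : _ = 1%E) ?mule1//; exact: polya_splitsT.
Qed.

Lemma integral_unit_polya_lik_ge0 beta :
  (0 <= \int[@polya_splits R L]_v (lik (beta, v))%:E)%E.
Proof. by apply: integral_ge0 => v _; rewrite lee_fin unit_polya_lik_ge0. Qed.

Lemma EFin_polya_prior beta :
  (polya_prior beta)%:E = (\int[@polya_splits R L]_v (lik (beta, v))%:E)%E.
Proof.
rewrite /polya_prior polya_intE// fineK// ge0_fin_numE.
  exact: le_lt_trans (integral_unit_polya_lik_le beta) (ltry _).
exact: integral_unit_polya_lik_ge0.
Qed.

Lemma polya_prior_ge0 beta : 0 <= polya_prior beta.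
Proof. by rewrite -lee_fin EFin_polya_prior integral_unit_polya_lik_ge0. Qed.

Lemma measurable_polya_prior : measurable_fun setT polya_prior.
Proof.
have -> : polya_prior = fine \o fubini_F (@polya_splits R L) (EFin \o lik).
  by apply/funext => beta; rewrite /= /fubini_F -EFin_polya_prior.
apply: measurableT_comp; first exact: fine_measurable.
apply: measurable_fun_fubini_tonelli_F => [|z]; last first.
  by rewrite lee_fin unit_polya_lik_ge0.
by apply/measurable_EFinP; exact: measurable_unit_polya_lik.
Qed.

Lemma polya_density_off (v : N.-tuple R) x : x \notin `[a, b] ->
  polya_density a b (node v) L x = 0.
Proof.
move=> xab; rewrite /polya_density big1// => k _.
rewrite indicE memNset ?mulr0// => /(dyadic_sub ab (ltn_ord k)) /= xab'.
by rewrite xab' in xab.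
Qed.

Lemma polya_prior_off beta : ~ cube a b beta -> polya_prior beta = 0.
Proof.
move=> /existsNP[j bj]; apply: EFin_inj; rewrite EFin_polya_prior.
rewrite integral0_eq// => v _; rewrite /unit_polya_lik (bigD1 j)//=.
by rewrite polya_density_off ?mul0r ?mulr0//; exact/negP.
Qed.

Lemma integral_polya_density (v : N.-tuple R) : unit_splits v ->
  (\int[lebesgue_measure]_x (polya_density a b (node v) L x)%:E = 1)%E.
Proof.
move=> gv; under eq_integral do rewrite -sumEFin.
have c0 (k : 'I_(2 ^ L)) : 0 <= (2 ^ L)%:R / (b - a) * polya_mass (node v) L k.
  rewrite mulr_ge0// ?divr_ge0 ?subr_ge0 ?(ltW ab)//.
  by rewrite polya_mass_ge0//; exact: node_unit_splits.
rewrite ge0_integral_sum//; last 2 first.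
- move=> k; apply/measurable_EFinP; apply: measurable_funM => //.
  by apply: measurable_indic; exact: measurable_dyadic.
- by move=> k x _; rewrite lee_fin mulr_ge0.
transitivity (\sum_(k < 2 ^ L) (polya_mass (node v) L k)%:E)%E; last first.
  by rewrite sumEFin sum_polya_mass.
apply: eq_bigr => k _.
under eq_integral do rewrite EFinM.
rewrite ge0_integralZl//; last 2 first.
- apply/measurable_EFinP.
  by apply: measurable_indic; exact: measurable_dyadic.
- by rewrite lee_fin.
rewrite integral_indic//; last exact: measurable_dyadic.
rewrite setIT [X in (_ * X)%E](_ : _ = ((b - a) / (2 ^ L)%:R)%:E); last first.
  exact: lebesgue_dyadic.
rewrite -EFinM; congr EFin; field.
by rewrite pnatr_eq0 expn_eq0 subr_eq0 (gt_eqF ab).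
Qed.

Lemma measurable_polya_density (v : N.-tuple R) :
  measurable_fun setT (polya_density a b (node v) L).
Proof.
apply: measurable_sum => k; apply: measurable_funM => //.
by apply: measurable_indic; exact: measurable_dyadic.
Qed.

(** Given the splits the coefficients are independent with a density of integral 1. *)
Lemma integral_polya_prior :
  (\int[lebesgue_tuple n]_beta (polya_prior beta)%:E = 1)%E.
Proof.
under eq_integral do rewrite EFin_polya_prior.
rewrite (fubini_tonelli (m1 := lebesgue_tuple n) (m2 := @polya_splits R L)
  (EFin \o lik)); last 2 first.
- by apply/measurable_EFinP; exact: measurable_unit_polya_lik.
- by move=> z; rewrite lee_fin unit_polya_lik_ge0.
transitivity (\int[@polya_splits R L]_v (\1_unit_splits v)%:E)%E; last first.
  rewrite integral_indic//; last exact: measurable_unit_splits.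
  by rewrite setIT; exact: polya_splits_unit.
apply: eq_integral => v _; rewrite /unit_polya_lik /= indicE.
case: (boolP (v \in unit_splits)) => [|_]; last first.
  by rewrite integral0_eq// => beta _; rewrite mul0r.
rewrite inE => gv; under eq_integral do rewrite mul1r.
rewrite (@integral_tuple_measure_prod _ _ _ (@lebesgue_measure R) _
  (fun=> polya_density a b (node v) L)).
- by rewrite big1// => j _; exact: integral_polya_density.
- by move=> _; exact: measurable_polya_density.
- by move=> _ x; exact: polya_density_ge0.
Qed.

(** Keep, in the density of each coefficient, the term of a cell that contains it.
What remains is (2^L / (b - a))^n times a monomial in the splits, integrated factor
by factor with [beta11_moment_ge]; as the exponents add up to n L, the powers of
2 cancel. *)
Lemma polya_prior_ge beta : cube a b beta ->
  ((b - a) ^+ n * n.+1%:R ^+ N)^-1 <= polya_prior beta.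
Proof.
move=> cb.
have /choice[k hk] : forall j, exists k : 'I_(2 ^ L), tnth beta j \in dyadic a b L k.
  by move=> j; exact: (dyadic_cover ab L (cb j)).
have [p [q [h1 h2 h3]]] := @prod_node_polya_mass_monomial R L n k.
pose c := (2 ^ L)%:R / (b - a).
have c0 : 0 <= c by rewrite divr_ge0// subr_ge0 ltW.
pose f (i : 'I_N) := @XMonemX R (p i) (q i) \_ `[0, 1].
have f0 i x : 0 <= f i x by exact: XMonemX_restrict_ge0.
have mf i : measurable_fun setT (f i) by exact: measurable_XMonemX_restrict.
rewrite -lee_fin EFin_polya_prior.
apply: (@le_trans _ _ (\int[@polya_splits R L]_v
    ((c ^+ n)%:E * (\prod_i f i (tnth v i))%:E))%E).
  rewrite ge0_integralZl//; last 3 first.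
  - apply/measurable_EFinP; apply: measurable_prod => i _.
    exact: (measurableT_comp (mf i) (measurable_tnth i)).
  - by move=> v _; rewrite lee_fin prodr_ge0.
  - by rewrite lee_fin exprn_ge0.
  rewrite (@integral_tuple_measure_prod _ _ _ (beta_prob 1 1) _ f)//.
  under eq_bigr do rewrite beta11_moment.
  rewrite prodEFin -EFinM lee_fin.
  apply: (@le_trans _ _ (c ^+ n * \prod_(i < N) (n.+1%:R * 2 ^+ (p i + q i))^-1)).
    rewrite prodfV big_split/= prodr_const card_ord prodrXr h3.
    have -> : c ^+ n = 2 ^+ (n * L) / (b - a) ^+ n.
      by rewrite expr_div_n natrX -exprM mulnC.
    have A0 : (b - a) ^+ n != 0 by rewrite expf_neq0// subr_eq0 gt_eqF.
    have B0 : n.+1%:R ^+ N != 0 :> R by rewrite expf_neq0// pnatr_eq0.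
    have D0 : 2 ^+ (n * L) != 0 :> R by rewrite expf_neq0// pnatr_eq0.
    rewrite le_eqVlt; apply/orP; left; apply/eqP.
    move: ((b - a) ^+ n) (n.+1%:R ^+ N) (2 ^+ (n * L)) A0 B0 D0 => A B D A0 B0 D0.
    by field; rewrite A0 B0 D0.
  rewrite ler_wpM2l ?exprn_ge0//; apply: ler_prod => i _.
  by rewrite invr_ge0 mulr_ge0 ?exprn_ge0//= beta11_moment_ge.
apply: ge0_le_integral_any => v; rewrite -EFinM lee_fin.
  by rewrite mulr_ge0 ?exprn_ge0// prodr_ge0.
rewrite /unit_polya_lik/= indicE; case: (boolP (v \in unit_splits)) => gv; last first.
  rewrite mul0r; move: gv; rewrite notin_setE => /existsNP[i vi].
  rewrite (bigD1 i)//= /f patchE memNset// ?mul0r ?mulr0//.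
rewrite inE in gv; rewrite mul1r.
have -> : \prod_i f i (tnth v i) = \prod_j polya_mass (node v) L (k j).
  rewrite h1 /monomial; apply: eq_bigr => i _.
  by rewrite /f patchE mem_set ?(tnth_nth 0)//; have := gv i; rewrite (tnth_nth 0).
rewrite -[n in _ ^+ n]card_ord -prodr_const -big_split/=.
apply: ler_prod => j _; rewrite mulr_ge0//= ?polya_mass_ge0//; last exact: node_unit_splits.
rewrite /polya_density (bigD1 (k j))//= indicE hk mulr1 lerDl.
apply: sumr_ge0 => i _; rewrite !mulr_ge0 ?polya_mass_ge0//; last exact: node_unit_splits.
by rewrite invr_ge0 subr_ge0 ltW.
Qed.

End polya_prior_density.

(** * The posterior distribution *)

Section jensen.
Context d (T : measurableType d) (R : realType).
Local Open Scope ereal_scope.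

(** Jensen's inequality for the square: integrate the inequality between
(x - v)^2 and its tangent at the mean mu of f. *)
Lemma sqr_fine_integral_le (P : {measure set T -> \bar R}) (f : T -> R) (v : R) :
  P setT = 1 -> P.-integrable setT (EFin \o f) ->
  ((fine (\int[P]_x (f x)%:E) - v) ^+ 2)%:E <= \int[P]_x ((f x - v) ^+ 2)%:E.
Proof.
move=> P1 intf; set mu := fine _.
have muE : \int[P]_x (f x)%:E = mu%:E by rewrite fineK//; exact: integrable_fin_num.
have mf : measurable_fun setT f by apply/measurable_EFinP; exact: (measurable_int P).
have mg : measurable_fun setT (fun x => ((f x - v) ^+ 2)%:E).
  by apply/measurable_EFinP; apply: measurable_funX; exact: measurable_funB.
have g0 x : 0 <= ((f x - v) ^+ 2)%:E by rewrite lee_fin sqr_ge0.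
have [goo|goo] := ltP (\int[P]_x ((f x - v) ^+ 2)%:E) +oo; last first.
  by rewrite (le_trans _ goo)// leey.
have intg : P.-integrable setT (fun x => ((f x - v) ^+ 2)%:E).
  apply/integrableP; split => //.
  by under eq_integral do rewrite gee0_abs//.
(* the tangent is c1 + c2 x *)
pose c1 := ((mu - v) ^+ 2 - 2 * (mu - v) * mu)%R.
pose c2 := (2 * (mu - v))%R.
have intc : P.-integrable setT (cst c1%:E).
  apply/integrableP; split => //.
  by rewrite [X in X < _](_ : _ = \int[P]_x cst `|c1%:E| x)// integral_cst// P1 mule1 ltry.
have intf2 : P.-integrable setT (fun x => c2%:E * (f x)%:E) by exact: integrableZl.
apply: (@le_trans _ _ (\int[P]_x (cst c1%:E x + c2%:E * (f x)%:E))).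
  rewrite integralD// integral_cst// integralZl// P1 mule1 muE -EFinM -EFinD lee_fin.
  by rewrite /c1 /c2; nra.
apply: le_integral => //; first exact: integrableD.
move=> x _; rewrite /= -EFinM -EFinD lee_fin /c1 /c2.
by have := sqr_ge0 (f x - mu); nra.
Qed.

End jensen.

Section posterior.
Context {R : realType}.
Variables (m n : nat) (X : 'M[R]_(m, n)) (sigma2 a b : R) (L : nat).
Hypotheses (ab : a < b) (sigma20 : 0 < sigma2).
Local Notation leb k := (@lebesgue_tuple R k).
Local Notation prior := (@polya_prior R a b L n).

Definition likelihood (z : n.-tuple R * m.-tuple R) : R :=
  \prod_i normal_pdf ((X *m col_of_tuple z.1) i ord0) (Num.sqrt sigma2) (tnth z.2 i).

Let s0 : 0 < Num.sqrt sigma2. Proof. by rewrite sqrtr_gt0. Qed.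
Let s0' : Num.sqrt sigma2 != 0. Proof. by rewrite gt_eqF. Qed.

Lemma likelihood_ge0 z : 0 <= likelihood z.
Proof. by apply: prodr_ge0 => i _; exact: normal_pdf_ge0. Qed.

Lemma likelihood_le z : likelihood z <= normal_peak (Num.sqrt sigma2) ^+ m.
Proof.
rewrite -[m in _ ^+ m]card_ord -prodr_const; apply: ler_prod => i _.
by rewrite normal_pdf_ge0 normal_pdf_ub.
Qed.

Lemma likelihoodE beta y : likelihood (beta, y) =
  normal_peak (Num.sqrt sigma2) ^+ m *
  expR (- (sqnorm2 (col_of_tuple y - X *m col_of_tuple beta) / (2 * sigma2))).
Proof.
rewrite /likelihood /= -[m in _ ^+ m]card_ord -prodr_const mulr_suml -sumrN.
rewrite expR_sum -big_split/=.
apply: eq_bigr => i _; rewrite normal_pdfE// /normal_fun; congr (_ * expR _).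
rewrite sqr_sqrtr ?(ltW sigma20)// !mxE mulNr; congr (- (_ / _)).
by rewrite mulr_natl.
Qed.

Lemma measurable_design_row i :
  measurable_fun setT (fun beta : n.-tuple R => (X *m col_of_tuple beta) i ord0).
Proof.
under eq_fun do rewrite mxE.
apply: measurable_sum => j; apply: measurable_funM => //.
by under eq_fun do rewrite mxE; exact: measurable_tnth.
Qed.

Lemma measurable_likelihood : measurable_fun setT likelihood.
Proof.
apply: measurable_prod => i _; under eq_fun do rewrite normal_pdfE//.
apply: measurable_funM => //; apply: measurableT_comp => //.
apply: measurable_funM => //; apply: measurableT_comp => //.
apply: measurable_funX; apply: measurable_funB.
  exact: (measurableT_comp (measurable_tnth i)).
exact: (measurableT_comp (measurable_design_row i)).
Qed.

Definition joint (y : m.-tuple R) (beta : n.-tuple R) := likelihood (beta, y) * prior beta.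

Lemma joint_ge0 y beta : 0 <= joint y beta.
Proof. by rewrite mulr_ge0 ?likelihood_ge0 ?polya_prior_ge0. Qed.

Lemma measurable_joint y : measurable_fun setT (joint y).
Proof.
apply: measurable_funM; last exact: measurable_polya_prior.
exact: (measurableT_comp measurable_likelihood (pair2_measurable y)).
Qed.

Definition evidence y : \bar R := (\int[leb n]_beta (joint y beta)%:E)%E.

Lemma lebesgue_cube : leb n (cube a b) = ((b - a) ^+ n)%:E.
Proof.
rewrite -[X in leb n X]setIT -integral_indic//; last exact: measurable_cube.
transitivity (\int[leb n]_v (\prod_(j < n) \1_(`[a, b]%classic : set R) (tnth v j))%:E)%E.
  by apply: eq_integral => v _; rewrite indic_cube.
rewrite (@integral_tuple_measure_prod _ _ _ (@lebesgue_measure R) _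
  (fun=> \1_(`[a, b]%classic : set R)))//.
rewrite (eq_bigr (fun=> (b - a)%:E)) => [|j _]; last first.
  rewrite integral_indic// setIT; apply: etrans (lebesgue_measure_itv _) _.
  by rewrite /= lte_fin ab EFinB.
by rewrite prodEFin prodr_const card_ord.
Qed.

(** The integrand is positive on the cube, which has positive volume. *)
Lemma evidence_gt0 y : (0 < evidence y)%E.
Proof.
rewrite lt_neqAle; apply/andP; split; last first.
  by apply: integral_ge0 => beta _; rewrite lee_fin joint_ge0.
apply/eqP => /esym e0.
have : (\int[leb n]_beta `|(joint y beta)%:E| = 0)%E.
  by rewrite -[RHS]e0; apply: eq_integral => beta _; rewrite gee0_abs// lee_fin joint_ge0.
have mj : measurable_fun setT (EFin \o joint y).
  by apply/measurable_EFinP; exact: measurable_joint.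
move/(ae_eq_integral_abs (leb n) measurableT mj) => [A [mA A0 jA]].
have cA : cube a b `<=` A.
  move=> beta cb; apply: jA => /= /(_ Logic.I) [] /eqP; apply/negP.
  rewrite gt_eqF// mulr_gt0//.
    by rewrite likelihoodE mulr_gt0 ?expR_gt0// exprn_gt0// normal_peak_gt0.
  apply: lt_le_trans (polya_prior_ge L ab cb).
  by rewrite invr_gt0 mulr_gt0// exprn_gt0// subr_gt0.
have : (leb n (cube a b) <= leb n A)%E.
  by apply: le_measure => //; rewrite inE//; exact: measurable_cube.
by rewrite A0 lebesgue_cube lee_fin leNgt exprn_gt0// subr_gt0.
Qed.

Lemma evidence_lty y : (evidence y < +oo)%E.
Proof.
apply: (@le_lt_trans _ _ (normal_peak (Num.sqrt sigma2) ^+ m)%:E); last exact: ltry.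
apply: (@le_trans _ _ (\int[leb n]_beta
    ((normal_peak (Num.sqrt sigma2) ^+ m)%:E * (prior beta)%:E))%E).
  apply: ge0_le_integral_any => beta; rewrite -?EFinM lee_fin ?joint_ge0//.
  by rewrite ler_wpM2r ?polya_prior_ge0 ?likelihood_le.
rewrite ge0_integralZl//.
- by rewrite integral_polya_prior// mule1.
- by apply/measurable_EFinP; exact: measurable_polya_prior.
- by move=> beta _; rewrite lee_fin polya_prior_ge0.
- by rewrite lee_fin exprn_ge0// normal_peak_ge0.
Qed.

End posterior.

Section posterior_risk.
Context {R : realType}.
Variables (m n : nat) (X : 'M[R]_(m, n)) (sigma2 a b : R) (L : nat).
Hypotheses (ab : a < b) (sigma20 : 0 < sigma2).
Local Notation leb k := (@lebesgue_tuple R k).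
Local Notation prior := (@polya_prior R a b L n).
Local Notation joint := (@joint R m n X sigma2 a b L).
Local Notation evidence := (@evidence R m n X sigma2 a b L).
Local Notation likelihood := (@likelihood R m n X sigma2).
Local Notation post := (@posterior R m n X sigma2 a b L).
Local Notation peak := (normal_peak (Num.sqrt sigma2) ^+ m).

Let peak_gt0 : 0 < peak.
Proof. by rewrite exprn_gt0// normal_peak_gt0// gt_eqF// sqrtr_gt0. Qed.

(** The joint density without the normalizing constant of the normal law, as in
the formula that defines the posterior. *)
Definition posterior_kernel (y : m.-tuple R) (beta : n.-tuple R) : R :=
  peak^-1 * joint y beta.

Lemma measurable_posterior_kernel y : measurable_fun setT (posterior_kernel y).
Proof. by apply: measurable_funM => //; exact: measurable_joint. Qed.

Lemma posterior_kernel_ge0 y beta : 0 <= posterior_kernel y beta.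
Proof. by rewrite mulr_ge0 ?joint_ge0// invr_ge0 ltW. Qed.

Lemma posterior_weightE y beta :
  posterior_weight X sigma2 a b L y beta = (posterior_kernel y beta)%:E.
Proof.
rewrite /posterior_weight polya_intE// -EFin_polya_prior// -EFinM; congr EFin.
by rewrite /posterior_kernel /joint likelihoodE// !mulrA mulVf ?mul1r// gt_eqF.
Qed.

Lemma integral_cube_posterior_weight y A :
  (\int[leb n]_(beta in cube a b `&` A) posterior_weight X sigma2 a b L y beta =
   \int[leb n]_(beta in A) (posterior_kernel y beta)%:E)%E.
Proof.
rewrite integral_mkcondl; apply: eq_integral => beta _.
rewrite patchE posterior_weightE; case: ifPn => //.
rewrite notin_setE => /polya_prior_off h.
by rewrite /posterior_kernel /joint h// !mulr0.
Qed.

Let norm_ge0 y :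
  0 <= (fine (\int[leb n]_beta (posterior_kernel y beta)%:E)%E)^-1.
Proof.
rewrite invr_ge0 fine_ge0// integral_ge0// => beta _.
by rewrite lee_fin posterior_kernel_ge0.
Qed.

Let id_tuple : n.-tuple (measurableTypeR R) -> n.-tuple R := idfun.

Let measurable_id_tuple : measurable_fun setT id_tuple.
Proof. by move=> _ Y mY; rewrite setTI. Qed.

Definition unnormalized_posterior y : {measure set (n.-tuple R) -> \bar R} :=
  density_law (leb n) (measurable_posterior_kernel y) (posterior_kernel_ge0 y)
    measurable_id_tuple.

Local Notation posterior_measure y :=
  (mscale (NngNum (norm_ge0 y)) (unnormalized_posterior y)).

Lemma posteriorE y : post y = posterior_measure y.
Proof.
apply/funext => A; rewrite /posterior /= /mscale /=.
rewrite -[X in fine (\int[_]_(_ in X) _)%E]setIT !integral_cube_posterior_weight.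
by rewrite muleC.
Qed.

(** The constant by which [posterior_kernel] and [joint] differ cancels. *)
Lemma integral_posterior y (f : n.-tuple R -> R) : measurable_fun setT f ->
  (forall beta, 0 <= f beta) ->
  (\int[post y]_beta (f beta)%:E =
   (\int[leb n]_beta (f beta * joint y beta)%:E) * ((fine (evidence y))^-1)%:E)%E.
Proof.
move=> mf f0; rewrite posteriorE.
have mfE : measurable_fun setT (EFin \o f) by exact/measurable_EFinP.
have f0E beta : setT beta -> (0 <= (EFin \o f) beta)%E by move=> _; rewrite lee_fin.
apply: etrans (ge0_integral_mscale (unnormalized_posterior y) measurableT
  (NngNum (norm_ge0 y)) mfE f0E) _.
rewrite integral_density_law//.
have mj : measurable_fun setT (joint y) by exact: measurable_joint.
have -> : (\int[leb n]_beta ((f beta)%:E * (posterior_kernel y beta)%:E) =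
   peak^-1%:E * \int[leb n]_beta (f beta * joint y beta)%:E)%E.
  rewrite -ge0_integralZl//.
  - by apply: eq_integral => beta _; rewrite -!EFinM mulrCA.
  - by apply/measurable_EFinP; exact: measurable_funM.
  - by move=> beta _; rewrite lee_fin mulr_ge0 ?joint_ge0.
  - by rewrite lee_fin invr_ge0 ltW.
rewrite [X in (X%:E * _)%E](_ : _ =
  (fine (\int[leb n]_beta (posterior_kernel y beta)%:E))^-1)//.
have -> : (\int[leb n]_beta (posterior_kernel y beta)%:E = peak^-1%:E * evidence y)%E.
  rewrite -ge0_integralZl//.
  - exact/measurable_EFinP.
  - by move=> beta _; rewrite lee_fin joint_ge0.
  - by rewrite lee_fin invr_ge0 ltW.
have [e0 eoo] := (evidence_gt0 X L ab sigma20 y, evidence_lty X L ab sigma20 y).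
have ef : evidence y \is a fin_num by rewrite ge0_fin_numE// ltW.
rewrite -{1}(fineK ef) -EFinM /= invfM invrK muleA -EFinM mulrAC.
by rewrite divff ?gt_eqF// mul1r muleC.
Qed.

Let mass_unit y : posterior_measure y setT = 1%E.
Proof.
have e0 := evidence_gt0 X L ab sigma20 y.
have ef : evidence y \is a fin_num by rewrite ge0_fin_numE ?evidence_lty// ltW.
have : (\int[post y]_beta (cst 1 beta)%:E = 1)%E.
  rewrite integral_posterior//.
  under eq_integral do rewrite mul1r.
  rewrite -/(evidence y) -[X in (X * _)%E](fineK ef) -EFinM divff//.
  by rewrite gt_eqF// fine_gt0// e0 evidence_lty.
by rewrite posteriorE => <-; rewrite -[LHS]mul1e -integral_cst.
Qed.

Let integrable_coordinate y j :
  (posterior_measure y).-integrable setT (fun beta => (tnth beta j)%:E).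
Proof.
have mt : measurable_fun setT (fun beta : n.-tuple R => (tnth beta j)%:E).
  by apply/measurable_EFinP; exact: measurable_tnth.
apply/integrableP; split => //.
suff : (\int[post y]_beta (`|tnth beta j|)%:E < +oo)%E by rewrite posteriorE.
rewrite (integral_posterior y (f := fun beta => `|tnth beta j|))//; last first.
  by apply: measurableT_comp => //; exact: measurable_tnth.
have mj : measurable_fun setT (joint y) by exact: measurable_joint.
have e0 := evidence_gt0 X L ab sigma20 y.
have ef : evidence y \is a fin_num by rewrite ge0_fin_numE ?evidence_lty// ltW.
pose B := `|a| + `|b|.
apply: (@le_lt_trans _ _ ((B%:E * evidence y) * ((fine (evidence y))^-1)%:E)%E); last first.
  by rewrite -[X in (_ * X * _)%E](fineK ef) -!EFinM ltry.
rewrite lee_wpmul2r ?lee_fin ?invr_ge0 ?fine_ge0 ?(ltW e0)//.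
rewrite -ge0_integralZl//; last 3 first.
- exact/measurable_EFinP.
- by move=> beta _; rewrite lee_fin joint_ge0.
- by rewrite lee_fin addr_ge0.
apply: ge0_le_integral_any => beta; first by rewrite lee_fin mulr_ge0 ?joint_ge0.
rewrite -EFinM lee_fin.
have [cb|/polya_prior_off h] := pselect (cube a b beta); last first.
  by rewrite /joint h// !mulr0.
rewrite ler_wpM2r ?joint_ge0//; have := cb j; rewrite in_itv/= => /andP[h1 h2].
have := ler_norm b; have := ler_norm (- a); rewrite normrN /B => h3 h4.
have := normr_ge0 a; have := normr_ge0 b => h5 h6.
by rewrite ler_norml; apply/andP; split; lra.
Qed.

Lemma sqnorm2_posterior_mean_le y (v : 'cV[R]_n) :
  ((sqnorm2 (posterior_mean X sigma2 a b L y - v))%:E <=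
   \int[post y]_beta (sqnorm2 (col_of_tuple beta - v))%:E)%E.
Proof.
have E beta : sqnorm2 (col_of_tuple beta - v) = \sum_j (tnth beta j - v j ord0) ^+ 2.
  by apply: eq_bigr => j _; rewrite !mxE.
rewrite posteriorE; under eq_integral do rewrite E -sumEFin.
rewrite ge0_integral_sum//; last 2 first.
- move=> j; apply/measurable_EFinP; apply: measurable_funX; apply: measurable_funB => //.
  exact: measurable_tnth.
- by move=> j beta _; rewrite lee_fin sqr_ge0.
rewrite /sqnorm2 -sumEFin; apply: lee_sum => j _.
rewrite !mxE posteriorE.
apply: (sqr_fine_integral_le (f := fun beta => tnth beta j) (v j ord0) (mass_unit y)).
exact: integrable_coordinate.
Qed.

Lemma measurable_sqnorm2_coef (v : 'cV[R]_n) :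
  measurable_fun setT (fun beta : n.-tuple R => sqnorm2 (col_of_tuple beta - v)).
Proof.
apply: measurable_sum => j; apply: measurable_funX.
under eq_fun do rewrite !mxE.
by apply: measurable_funB => //; exact: measurable_tnth.
Qed.

(** Jensen's inequality bounds the left-hand side by the posterior
expectation of x = s |beta - v|^2, and x <= c - 1 + e^-c e^x because the right-hand side is the
exponential e^(x - c) shifted so as to be tangent to the diagonal at x = c. *)
Lemma posterior_mean_expR_le y (v : 'cV[R]_n) (s c : R) : 0 <= s -> 1 <= c ->
  ((s * sqnorm2 (posterior_mean X sigma2 a b L y - v))%:E <=
   (c - 1)%:E + (expR (- c))%:E *
   \int[post y]_beta (expR (s * sqnorm2 (col_of_tuple beta - v)))%:E)%E.
Proof.
move=> s0 c1.
have mq := measurable_sqnorm2_coef v.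
have me : measurable_fun setT
    (fun beta : n.-tuple R => expR (s * sqnorm2 (col_of_tuple beta - v))).
  by apply: measurableT_comp => //; apply: measurable_funM.
apply: (@le_trans _ _ (s%:E * \int[post y]_beta (sqnorm2 (col_of_tuple beta - v))%:E)%E).
  by rewrite EFinM lee_wpmul2l ?lee_fin ?sqnorm2_posterior_mean_le.
rewrite posteriorE -ge0_integralZl//; last 2 first.
- exact/measurable_EFinP.
- by move=> beta _; rewrite lee_fin sqnorm2_ge0.
rewrite -ge0_integralZl//; last exact/measurable_EFinP.
rewrite -[X in (X + _)%E]mule1 -(mass_unit y) -integral_cst//.
rewrite -ge0_integralD//; last 2 first.
- by move=> beta _; rewrite lee_fin subr_ge0.
- by apply/measurable_EFinP; apply: measurable_funM.
apply: ge0_le_integral_any => beta; rewrite -?EFinM lee_fin ?mulr_ge0 ?sqnorm2_ge0//.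
have := expR_ge1Dx (s * sqnorm2 (col_of_tuple beta - v) - c).
by rewrite expRD mulrC; lra.
Qed.

End posterior_risk.

(** * Expectations under the true law *)

Section true_model_moments.
Context {R : realType}.
Variables (m n : nat) (X : 'M[R]_(m, n)) (sigma2 a b : R) (L : nat) (g0 : R -> R).
Hypotheses (ab : a < b) (sigma20 : 0 < sigma2) (hg0 : is_density g0).
Local Notation leb k := (@lebesgue_tuple R k).
Local Notation prior := (@polya_prior R a b L n).
Local Notation joint := (@joint R m n X sigma2 a b L).
Local Notation evidence := (@evidence R m n X sigma2 a b L).
Local Notation likelihood := (@likelihood R m n X sigma2).
Local Notation post := (@posterior R m n X sigma2 a b L).
Local Notation density := (@true_density R m n X sigma2 g0).

Let g00 x : 0 <= g0 x. Proof. by case: hg0. Qed.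
Let mg0 : measurable_fun setT g0. Proof. by case: hg0. Qed.
Let int_g0 : (\int[lebesgue_measure]_x (g0 x)%:E = 1)%E. Proof. by case: hg0. Qed.

Let s0 : 0 < Num.sqrt sigma2. Proof. by rewrite sqrtr_gt0. Qed.

Let g0prod_ge0 (beta : n.-tuple R) : 0 <= \prod_j g0 (tnth beta j).
Proof. by apply: prodr_ge0. Qed.

Let measurable_g0prod :
  measurable_fun setT (fun beta : n.-tuple R => \prod_j g0 (tnth beta j)).
Proof.
apply: measurable_prod => j _.
exact: (measurableT_comp mg0 (measurable_tnth j)).
Qed.

Let true_densityE beta y :
  density (beta, y) = \prod_j g0 (tnth beta j) * likelihood (beta, y).
Proof. by []. Qed.

Lemma true_density_ge0 z : 0 <= density z.
Proof. by rewrite mulr_ge0// likelihood_ge0. Qed.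

Lemma measurable_true_density : measurable_fun setT density.
Proof.
apply: measurable_funM.
  exact: (measurableT_comp measurable_g0prod measurable_fst).
exact: measurable_likelihood.
Qed.

Let id_pair : n.-tuple (measurableTypeR R) * m.-tuple (measurableTypeR R) ->
  n.-tuple R * m.-tuple R := idfun.

Let measurable_id_pair : measurable_fun setT id_pair.
Proof. by move=> _ Y mY; rewrite setTI. Qed.

Definition true_law_measure : {measure set (n.-tuple R * m.-tuple R) -> \bar R} :=
  density_law (leb n \x leb m)%E measurable_true_density true_density_ge0
    measurable_id_pair.

Lemma true_lawE : true_law X sigma2 g0 = true_law_measure.
Proof. by []. Qed.

Lemma integral_true_law (f : n.-tuple R * m.-tuple R -> \bar R) :
  measurable_fun setT f -> (forall z, 0 <= f z)%E ->
  (\int[true_law X sigma2 g0]_z f z =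
   \int[leb n]_beta \int[leb m]_y (f (beta, y) * (density (beta, y))%:E))%E.
Proof.
move=> mf f0; rewrite true_lawE integral_density_law// fubini_tonelli1//.
- apply: emeasurable_funM => //; apply/measurable_EFinP; exact: measurable_true_density.
- by move=> z; rewrite mule_ge0// lee_fin true_density_ge0.
Qed.

Lemma integral_likelihood beta : (\int[leb m]_y (likelihood (beta, y))%:E = 1)%E.
Proof.
rewrite (@integral_tuple_measure_prod _ _ _ (@lebesgue_measure R) _
  (fun i => normal_pdf ((X *m col_of_tuple beta) i ord0) (Num.sqrt sigma2))).
- by rewrite big1// => i _; exact: integral_normal_pdf.
- by move=> i; exact: measurable_normal_pdf.
- by move=> i x; exact: normal_pdf_ge0.
Qed.

Lemma integral_true_prior :
  (\int[leb n]_beta (\prod_j g0 (tnth beta j))%:E = 1)%E.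
Proof.
rewrite (@integral_tuple_measure_prod _ _ _ (@lebesgue_measure R) _ (fun=> g0))//.
by rewrite big1.
Qed.

Lemma true_lawT : true_law X sigma2 g0 setT = 1%E.
Proof.
have : (\int[true_law X sigma2 g0]_z (cst 1%E z) = 1)%E.
  rewrite integral_true_law//.
  rewrite -[RHS]integral_true_prior; apply: eq_integral => beta _.
  under eq_integral do rewrite mul1e true_densityE EFinM.
  rewrite ge0_integralZl//.
  - by rewrite integral_likelihood mule1.
  - apply/measurable_EFinP.
    exact: (measurableT_comp (measurable_likelihood X sigma20) (pair1_measurable beta)).
  - by move=> y _; rewrite lee_fin likelihood_ge0.
  - by rewrite lee_fin.
by rewrite true_lawE integral_cst// mul1e.
Qed.

Variables (lossf : n.-tuple R * m.-tuple R -> R) (B M : R).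
Hypotheses (mloss : measurable_fun setT lossf) (loss0 : forall z, 0 <= lossf z).
Hypothesis lossB : forall beta,
  (\int[leb m]_y (lossf (beta, y) * likelihood (beta, y))%:E <= B%:E)%E.

Let mlik : measurable_fun setT likelihood.
Proof. exact: measurable_likelihood. Qed.

Let B0 : 0 <= B.
Proof.
have [beta] : exists beta : n.-tuple R, True by exists [tuple of nseq n 0].
move=> _; rewrite -lee_fin; apply: le_trans (lossB beta).
by apply: integral_ge0 => y _; rewrite lee_fin mulr_ge0 ?likelihood_ge0.
Qed.

Let mloss_lik beta : measurable_fun setT
  (fun y : m.-tuple R => (lossf (beta, y) * likelihood (beta, y))%:E).
Proof.
apply/measurable_EFinP; apply: measurable_funM.
  exact: (measurableT_comp mloss (pair1_measurable beta)).
exact: (measurableT_comp mlik (pair1_measurable beta)).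
Qed.

(* the bound B holds for each beta, hence on average under any prior p *)
Let integral_weighted_loss_le (p : n.-tuple R -> R) : measurable_fun setT p ->
  (forall beta, 0 <= p beta) -> (\int[leb n]_beta (p beta)%:E = 1)%E ->
  (\int[leb n]_beta \int[leb m]_y (lossf (beta, y) * (p beta * likelihood (beta, y)))%:E
   <= B%:E)%E.
Proof.
move=> mp p0 p1; apply: (@le_trans _ _ (\int[leb n]_beta (B%:E * (p beta)%:E))%E).
  apply: ge0_le_integral_any => beta.
    by apply: integral_ge0 => y _; rewrite lee_fin !mulr_ge0 ?likelihood_ge0.
  under eq_integral do rewrite mulrCA EFinM.
  rewrite ge0_integralZl//.
  - by rewrite muleC lee_wpmul2r ?lee_fin.
  - exact: mloss_lik.
  - by move=> y _; rewrite lee_fin mulr_ge0 ?likelihood_ge0.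
  - by rewrite lee_fin.
rewrite ge0_integralZl//.
- by rewrite p1 mule1.
- exact/measurable_EFinP.
- by move=> beta _; rewrite lee_fin.
Qed.

Lemma integral_true_law_loss_le :
  (\int[true_law X sigma2 g0]_z (lossf z)%:E <= B%:E)%E.
Proof.
rewrite integral_true_law//; last exact/measurable_EFinP.
exact: (integral_weighted_loss_le measurable_g0prod g0prod_ge0 integral_true_prior).
Qed.

Hypothesis M0 : 0 <= M.
Hypothesis prior_dominates : forall beta, \prod_j g0 (tnth beta j) <= M * prior beta.

Definition posterior_loss (y : m.-tuple R) : \bar R :=
  (\int[post y]_beta (lossf (beta, y))%:E)%E.

Let N (y : m.-tuple R) := (\int[leb n]_beta (lossf (beta, y) * joint y beta)%:E)%E.

Let mloss_joint : measurable_fun setT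
  (fun z : n.-tuple R * m.-tuple R => (lossf z * joint z.2 z.1)%:E).
Proof.
apply/measurable_EFinP; apply: measurable_funM => //.
rewrite (_ : (fun z => _) = fun z => likelihood z * prior z.1); last first.
  by apply/funext => -[].
apply: measurable_funM => //.
exact: (measurableT_comp (measurable_polya_prior L ab) measurable_fst).
Qed.

Let posterior_lossE y : posterior_loss y = (N y * ((fine (evidence y))^-1)%:E)%E.
Proof.
rewrite /posterior_loss integral_posterior//.
exact: (measurableT_comp mloss (pair2_measurable y)).
Qed.

Lemma posterior_loss_ge0 y : (0 <= posterior_loss y)%E.
Proof.
rewrite posterior_lossE mule_ge0//.
  by apply: integral_ge0 => beta _; rewrite lee_fin mulr_ge0 ?joint_ge0.
by rewrite lee_fin invr_ge0 fine_ge0// ltW// evidence_gt0.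
Qed.

Lemma measurable_posterior_loss : measurable_fun setT posterior_loss.
Proof.
rewrite (_ : posterior_loss = fun y => N y * ((fine (evidence y))^-1)%:E)%E; last first.
  by apply/funext => y; exact: posterior_lossE.
apply: emeasurable_funM.
  apply: (measurable_fun_fubini_tonelli_G (m1 := leb n)
    (fun z => (lossf z * joint z.2 z.1)%:E)) => //.
  by move=> z; rewrite lee_fin mulr_ge0 ?joint_ge0.
apply/measurable_EFinP.
(* the evidence is positive, so that its inverse is a power, a measurable function *)
rewrite (_ : (fun y => _) = (@powR R ^~ (-1)) \o (fine \o evidence)); last first.
  by apply/funext => y /=; rewrite powR_inv1// fine_ge0// ltW// evidence_gt0.
apply: measurableT_comp; first exact: measurable_powR.
apply: measurableT_comp; first exact: fine_measurable.
apply: (measurable_fun_fubini_tonelli_G (m1 := leb n)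
  (fun z => (joint z.2 z.1)%:E)) => [|z]; last by rewrite lee_fin joint_ge0.
apply/measurable_EFinP.
rewrite (_ : (fun z => _) = fun z => likelihood z * prior z.1); last first.
  by apply/funext => -[].
apply: measurable_funM => //.
exact: (measurableT_comp (measurable_polya_prior L ab) measurable_fst).
Qed.

(** Replacing the true prior by M times the working one turns the law of the data
into M times the evidence, which cancels the denominator of the posterior: there
remains M times the expectation of the loss in the working model. *)
Lemma integral_true_law_posterior_loss_le :
  (\int[true_law X sigma2 g0]_z posterior_loss z.2 <= (M * B)%:E)%E.
Proof.
rewrite integral_true_law; last 2 first.
- exact: (measurableT_comp measurable_posterior_loss measurable_snd).
- by move=> z; exact: posterior_loss_ge0.
rewrite (fubini_tonelli (m1 := leb n) (m2 := leb m)
  (fun z => posterior_loss z.2 * (density z)%:E)%E)/=; last 2 first.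
- apply: emeasurable_funM.
    exact: (measurableT_comp measurable_posterior_loss measurable_snd).
  by apply/measurable_EFinP; exact: measurable_true_density.
- by move=> z; rewrite mule_ge0 ?posterior_loss_ge0// lee_fin true_density_ge0.
apply: (@le_trans _ _ (\int[leb m]_y (M%:E * N y))%E).
  apply: ge0_le_integral_any => y.
    apply: integral_ge0 => beta _.
    by rewrite mule_ge0 ?posterior_loss_ge0// lee_fin true_density_ge0.
  apply: (@le_trans _ _ (\int[leb n]_beta
      (posterior_loss y * ((M * joint y beta)%:E)))%E).
    apply: ge0_le_integral_any => beta.
      by rewrite mule_ge0 ?posterior_loss_ge0// lee_fin true_density_ge0.
    rewrite lee_wpmul2l ?posterior_loss_ge0// lee_fin.
    rewrite true_densityE mulrC.
    rewrite (_ : M * joint y beta = likelihood (beta, y) * (M * prior beta)).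
      by rewrite ler_wpM2l ?likelihood_ge0.
    by rewrite mulrCA.
  have mj : measurable_fun setT (joint y) by exact: measurable_joint.
  rewrite ge0_integralZl//; last 3 first.
  - by apply/measurable_EFinP; exact: measurable_funM.
  - by move=> beta _; rewrite lee_fin mulr_ge0 ?joint_ge0.
  - exact: posterior_loss_ge0.
  under eq_integral do rewrite EFinM.
  rewrite ge0_integralZl//; last 2 first.
  - exact/measurable_EFinP.
  - by move=> beta _; rewrite lee_fin joint_ge0.
  have e0 := evidence_gt0 X L ab sigma20 y.
  have ef : evidence y \is a fin_num by rewrite ge0_fin_numE ?evidence_lty// ltW.
  rewrite -/(evidence y) posterior_lossE muleCA -muleA.
  rewrite -[X in (_ * (_ * (_ * X)))%E](fineK ef).
  by rewrite -EFinM mulVf ?mule1// gt_eqF// fine_gt0// e0 evidence_lty.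
have N0 y : (0 <= N y)%E.
  by apply: integral_ge0 => beta _; rewrite lee_fin mulr_ge0 ?joint_ge0.
rewrite ge0_integralZl//; last first.
  apply: (measurable_fun_fubini_tonelli_G (m1 := leb n)
    (fun z => (lossf z * joint z.2 z.1)%:E)) => //.
  by move=> z; rewrite lee_fin mulr_ge0 ?joint_ge0.
rewrite EFinM lee_wpmul2l ?lee_fin//.
rewrite /N -(fubini_tonelli (m1 := leb n) (m2 := leb m)
  (fun z => (lossf z * joint z.2 z.1)%:E))//; last first.
  by move=> z; rewrite lee_fin mulr_ge0 ?joint_ge0.
rewrite /=.
apply: le_trans (integral_weighted_loss_le (measurable_polya_prior L ab)
  (polya_prior_ge0 L ab) (integral_polya_prior L n ab)).
apply: ge0_le_integral_any => beta.
  by apply: integral_ge0 => y _; rewrite lee_fin mulr_ge0 ?joint_ge0.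
rewrite le_eqVlt; apply/orP; left; apply/eqP.
by apply: eq_integral => y _; rewrite [_ * likelihood _]mulrC.
Qed.

End true_model_moments.

(** * The risk of the posterior mean *)

Section risk_bound.
Context {R : realType}.
Variables (m n : nat) (X : 'M[R]_(m, n)) (sigma2 a b : R) (L : nat) (g0 : R -> R).
Hypotheses (ab : a < b) (sigma20 : 0 < sigma2) (hg0 : is_density g0).
Hypotheses (n0 : (0 < n)%N) (rX : \rank X = n).
Local Notation leb k := (@lebesgue_tuple R k).
Local Notation prior := (@polya_prior R a b L n).
Local Notation lambda := (lambda_min (X^T *m X)).

Definition lsq (y : m.-tuple R) : 'cV[R]_n := (lsq_mx X)^T *m col_of_tuple y.

Let lambda_gt0 : 0 < lambda. Proof. exact: lambda_min_gram_gt0. Qed.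

(* chosen so that s sigma2 |lsq_mx X z|^2 <= |z|^2 / 4 *)
Let s := lambda / (4 * sigma2).

Let s_gt0 : 0 < s. Proof. by rewrite divr_gt0 ?mulr_gt0. Qed.

Definition lsq_loss (z : n.-tuple R * m.-tuple R) : R :=
  expR (s * sqnorm2 (col_of_tuple z.1 - lsq z.2)).

Lemma measurable_lsq_loss : measurable_fun setT lsq_loss.
Proof.
apply: measurableT_comp => //; apply: measurable_funM => //.
apply: measurable_sum => j; apply: measurable_funX.
under eq_fun do rewrite !mxE.
apply: measurable_funB; first exact: (measurableT_comp (measurable_tnth j)).
apply: measurable_sum => i; apply: measurable_funM => //.
under eq_fun do rewrite !mxE.
exact: (measurableT_comp (measurable_tnth i)).
Qed.

Lemma integral_lsq_loss_le beta :
  (\int[leb m]_y (lsq_loss (beta, y) * likelihood X sigma2 (beta, y))%:E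
   <= (Num.sqrt 2 ^+ n)%:E)%E.
Proof.
have ss0 : 0 < Num.sqrt sigma2 by rewrite sqrtr_gt0.
have W_le z : s * Num.sqrt sigma2 ^+ 2 * sqnorm2 (lsq_mx X *m z) <= sqnorm2 z / 4.
  rewrite sqr_sqrtr ?(ltW sigma20)//.
  have -> : s * sigma2 = lambda / 4 by rewrite /s; field; rewrite gt_eqF.
  by rewrite mulrAC ler_pM2r// sqnorm2_lsq_mx_le.
have := @gaussian_expR_sqnorm2_le R m n (lsq_mx X) (X *m col_of_tuple beta)
  _ s ss0 (ltW s_gt0) W_le.
apply: le_trans.
rewrite le_eqVlt; apply/orP; left; apply/eqP; apply: eq_integral => y _.
congr (expR (s * _) * _)%:E.
rewrite mulmxBr mulmxA lsq_mxK// mul1mx /= -/(lsq y).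
by rewrite -opprB -scaleN1r sqnorm2Z sqrrN expr1n mul1r.
Qed.

Variables (M c : R).
Hypotheses (M0 : 0 <= M) (c1 : 1 <= c).
Hypothesis prior_dominates :
  forall beta : n.-tuple R, \prod_j g0 (tnth beta j) <= M * prior beta.
Hypotheses (Mc : M * Num.sqrt 2 ^+ n <= expR c) (cn : Num.sqrt 2 ^+ n <= expR c).

(** Both s |posterior mean - lsq|^2 and s |beta - lsq|^2 are at most c - 1 plus
e^-c times an exponential loss of mean at most e^c, so each has mean at most c. *)
Lemma posterior_mean_risk_le :
  (posterior_mean_risk X sigma2 a b L g0 <= (16 * sigma2 * c / lambda)%:E)%E.
Proof.
pose pl := posterior_loss X sigma2 a b L lsq_loss.
have loss0 z : 0 <= lsq_loss z by exact: expR_ge0.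
have pl0 y : (0 <= pl y)%E by exact: posterior_loss_ge0 measurable_lsq_loss _ _.
have mpl : measurable_fun setT pl by exact: measurable_posterior_loss measurable_lsq_loss _.
pose G (z : n.-tuple R * m.-tuple R) : \bar R :=
  ((2 * (c - 1))%:E + (expR (- c))%:E * (pl z.2 + (lsq_loss z)%:E))%E.
have mpl2 : measurable_fun setT (fun z : n.-tuple R * m.-tuple R => pl z.2).
  exact: (measurableT_comp mpl measurable_snd).
have mG0 : measurable_fun setT (fun z => (pl z.2 + (lsq_loss z)%:E)%E).
  apply: emeasurable_funD => //; apply/measurable_EFinP; exact: measurable_lsq_loss.
have G00 z : (0 <= pl z.2 + (lsq_loss z)%:E)%E by rewrite adde_ge0// lee_fin.
have mG : measurable_fun setT G.
  apply: emeasurable_funD => //; exact: emeasurable_funM.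
have G0 z : (0 <= G z)%E.
  by rewrite adde_ge0// ?lee_fin ?mulr_ge0 ?subr_ge0// mule_ge0// lee_fin expR_ge0.
have s2 : 0 <= 2 / s by rewrite divr_ge0// ltW.
have ptw z : ((sqnorm2 (posterior_mean X sigma2 a b L z.2 - col_of_tuple z.1))%:E
    <= (2 / s)%:E * G z)%E.
  case: z => beta y /=.
  pose u := s * sqnorm2 (posterior_mean X sigma2 a b L y - lsq y).
  have pme : (u%:E <= (c - 1)%:E + (expR (- c))%:E * pl y)%E.
    exact: (posterior_mean_expR_le X L ab sigma20 y (lsq y) (ltW s_gt0) c1).
  pose w := s * sqnorm2 (col_of_tuple beta - lsq y).
  have wle : (w%:E <= (c - 1)%:E + (expR (- c))%:E * (lsq_loss (beta, y))%:E)%E.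
    rewrite -EFinM -EFinD lee_fin /lsq_loss /= -/w.
    by have := expR_ge1Dx (w - c); rewrite expRD mulrC; lra.
  apply: (@le_trans _ _ ((2 / s)%:E * (u%:E + w%:E))%E).
    rewrite -EFinD -EFinM lee_fin -mulrDr mulrA divfK ?gt_eqF//.
    exact: sqnorm2B_le.
  rewrite lee_wpmul2l//.
  apply: le_trans (leeD pme wle) _.
  rewrite [leRHS](_ : _ = (2 * (c - 1))%:E +
    (expR (- c))%:E * (pl y + (lsq_loss (beta, y))%:E))%E//.
  move: (pl y) (pl0 y) => p p0.
  rewrite ge0_muleDr// ?lee_fin// addeACA -EFinD le_eqVlt; apply/orP; left.
  by apply/eqP; congr ((_)%:E + _)%E; lra.
rewrite /posterior_mean_risk.
have intG : (\int[true_law X sigma2 g0]_z G z <= (2 * c)%:E)%E.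
  have ple := integral_true_law_posterior_loss_le ab sigma20 hg0 measurable_lsq_loss
    loss0 integral_lsq_loss_le M0 prior_dominates.
  have lle := integral_true_law_loss_le sigma20 hg0 measurable_lsq_loss loss0
    integral_lsq_loss_le.
  have TT := true_lawT X sigma20 hg0.
  move: ple lle TT; rewrite (true_lawE X sigma20 hg0) => ple lle TT.
  rewrite ge0_integralD//; last 3 first.
  - by move=> z _; rewrite lee_fin mulr_ge0// subr_ge0.
  - by move=> z _; rewrite mule_ge0// lee_fin expR_ge0.
  - exact: emeasurable_funM.
  rewrite integral_cst// TT mule1 ge0_integralZl//.
  rewrite ge0_integralD//; last 2 first.
  - by move=> z _; rewrite lee_fin.
  - by apply/measurable_EFinP; exact: measurable_lsq_loss.
  apply: (@le_trans _ _ ((2 * (c - 1))%:E +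
      (expR (- c))%:E * ((expR c)%:E + (expR c)%:E))%E).
    rewrite leeD2l// lee_wpmul2l ?lee_fin ?expR_ge0// leeD//.
      by apply: le_trans ple _; rewrite lee_fin.
    by apply: le_trans lle _; rewrite lee_fin.
  have e2 : expR (- c) * (expR c + expR c) = 2 by rewrite mulrDr -expRD addNr expR0.
  by rewrite lee_fin e2; lra.
apply: (@le_trans _ _ (\int[true_law X sigma2 g0]_z ((2 / s)%:E * G z))%E).
  rewrite (true_lawE X sigma20 hg0); apply: ge0_le_integral_any => // z.
  by rewrite lee_fin sqnorm2_ge0.
have -> : (16 * sigma2 * c / lambda)%:E = ((2 / s)%:E * (2 * c)%:E)%E.
  by rewrite -EFinM /s; congr EFin; field; rewrite !gt_eqF.
move: intG; rewrite (true_lawE X sigma20 hg0) => intG.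
by rewrite ge0_integralZl// lee_wpmul2l.
Qed.

End risk_bound.

(** On the cube the left-hand side is at most M1^n, and the bracket was chosen to
compensate the lower bound of the prior density; off the cube it vanishes. *)
Lemma polya_prior_dominates (R : realType) (a b M1 : R) (L n : nat) (g0 : R -> R) :
  a < b -> 0 <= M1 -> (forall x, 0 <= g0 x <= M1) ->
  (forall x, x \notin `[a, b] -> g0 x = 0) ->
  forall beta : n.-tuple R, \prod_j g0 (tnth beta j) <=
    ((M1 * (b - a)) ^+ n * n.+1%:R ^+ (2 ^ L).-1) * polya_prior a b L beta.
Proof.
move=> ab M10 g0M g0_supp beta.
have ba0 : 0 < b - a by rewrite subr_gt0.
have [cb|] := pselect (cube a b beta); last first.
  move=> /existsNP[j bj]; rewrite (bigD1 j)//= g0_supp ?mul0r; last exact/negP.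
  by rewrite !mulr_ge0 ?exprn_ge0 ?polya_prior_ge0 ?mulr_ge0// ltW.
apply: (@le_trans _ _ (M1 ^+ n)).
  by rewrite -[n in _ ^+ n]card_ord -prodr_const; apply: ler_prod => j _.
have P0 : 0 < (b - a) ^+ n * n.+1%:R ^+ (2 ^ L).-1 by rewrite mulr_gt0 ?exprn_gt0.
rewrite exprMn -!mulrA ler_peMr ?exprn_ge0// mulrA.
by rewrite -ler_pdivrMl// mulr1 polya_prior_ge.
Qed.

(** Take c = A (n + 2^L log (n + 1)) and M as in [polya_prior_dominates]: then
log M + n log 2 <= c. The hypothesis M0 (b - a) >= 1 makes log (M0 (b - a))
nonnegative, hence A >= 1 and M >= 1. *)
Lemma posterior_mean_risk_rate (R : realType) (m n : nat) (X : 'M[R]_(m, n))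
    (sigma2 a b M0 : R) (L : nat) (g0 : R -> R) :
  a < b -> 0 < sigma2 -> is_density g0 -> (0 < n)%N -> \rank X = n ->
  (forall x, x \notin `[a, b] -> g0 x = 0) -> (forall x, g0 x <= M0) ->
  1 <= M0 * (b - a) ->
  (posterior_mean_risk X sigma2 a b L g0 <=
   (16 * (1 + ln 2 + ln (M0 * (b - a))) *
    (sigma2 * (n%:R + (2 ^ L)%:R * ln n.+1%:R) / lambda_min (X^T *m X)))%:E)%E.
Proof.
move=> ab sigma20 hg0 n0 rX g0_supp g0_bound kappa1.
set A := 1 + ln 2 + ln (M0 * (b - a)); set r := n%:R + (2 ^ L)%:R * ln n.+1%:R.
have g00 x : 0 <= g0 x by case: hg0.
have M00 : 0 <= M0 by exact: le_trans (g00 0) (g0_bound 0).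
have lnk : 0 <= ln (M0 * (b - a)) by rewrite ln_ge0.
have ln2 : 0 <= ln 2 :> R by rewrite ln_ge0// ler1n.
have lnn : 0 <= ln n.+1%:R :> R by rewrite ln_ge0// ler1n.
have n1 : 1 <= n%:R :> R by rewrite ler1n.
have r1 : n%:R <= r by rewrite lerDl mulr_ge0.
have c1 : 1 <= A * r.
  by apply: mulr_ege1; [rewrite /A -addrA lerDl addr_ge0|exact: le_trans r1].
have k0 : 0 < M0 * (b - a) by exact: lt_le_trans kappa1.
have cE : (M0 * (b - a)) ^+ n * n.+1%:R ^+ (2 ^ L).-1 * 2 ^+ n <= expR (A * r).
  apply: (@le_trans _ _ ((M0 * (b - a)) ^+ n * n.+1%:R ^+ (2 ^ L) * 2 ^+ n)).
    rewrite ler_wpM2r ?exprn_ge0// ler_wpM2l ?exprn_ge0 ?(ltW k0)//.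
    by rewrite ler_weXn2l ?ler1n// leq_pred.
  have -> : (M0 * (b - a)) ^+ n * n.+1%:R ^+ (2 ^ L) * 2 ^+ n =
      expR (n%:R * ln (M0 * (b - a)) + (2 ^ L)%:R * ln n.+1%:R + n%:R * ln 2).
    by rewrite !expRD !expRM_natl !lnK// posrE.
  rewrite ler_expR /A /r.
  have : 0 <= (2 ^ L)%:R * ln n.+1%:R :> R by rewrite mulr_ge0.
  by nra.
(* sqrt 2 is replaced by 2 to keep the constants simple *)
have s2 : Num.sqrt 2 ^+ n <= 2 ^+ n :> R.
  rewrite lerXn2r ?nnegrE ?sqrtr_ge0// -[leRHS]ger0_norm// -sqrtr_sqr ler_sqrt//.
  by rewrite expr2 ler_peMr// ler1n.
pose M := (M0 * (b - a)) ^+ n * n.+1%:R ^+ (2 ^ L).-1.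
have M1 : 1 <= M by rewrite mulr_ege1// exprn_ege1// ler1n.
have M0' : 0 <= M by exact: le_trans M1.
have Mc : M * Num.sqrt 2 ^+ n <= expR (A * r).
  by apply: le_trans cE; rewrite ler_wpM2l.
have cn : Num.sqrt 2 ^+ n <= expR (A * r).
  by apply: le_trans Mc; rewrite ler_peMl// exprn_ge0// sqrtr_ge0.
have dom (beta : n.-tuple R) : \prod_j g0 (tnth beta j) <= M * polya_prior a b L beta.
  by apply: polya_prior_dominates => // x; rewrite g00 g0_bound.
apply: le_trans (posterior_mean_risk_le ab sigma20 hg0 n0 rX M0' c1 dom Mc cn) _.
rewrite lee_fin le_eqVlt; apply/orP; left; apply/eqP.
by rewrite -/A; ring.
Qed.

Theorem corollary4p3 (R : realType) (a b M0 : R) (g0 : R -> R)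
    (m_ n_ : nat -> nat) (X : forall m n : nat, 'M[R]_(m, n))
    (sigma2 : nat -> nat -> R) (L : nat -> nat -> nat)
    (hab : a < b)
    (hg0 : is_density g0)
    (hg0_supp : forall x, x \notin `[a, b] -> g0 x = 0)
    (hg0_bound : forall x, g0 x <= M0)
    (hnm : forall t, (n_ t <= m_ t)%N)
    (hm : m_ @ \oo --> \oo)
    (hn : n_ @ \oo --> \oo)
    (hsigma2 : forall t, 0 < sigma2 (m_ t) (n_ t))
    (hrank : forall t, \rank (X (m_ t) (n_ t)) = n_ t)
    (hrate : (fun t =>
        sigma2 (m_ t) (n_ t)
        * ((n_ t)%:R + (2 ^ L (m_ t) (n_ t))%:R * ln (n_ t).+1%:R)
        / lambda_min ((X (m_ t) (n_ t))^T *m X (m_ t) (n_ t))) @ \oo --> 0) :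
  (fun t =>
     posterior_mean_risk (X (m_ t) (n_ t)) (sigma2 (m_ t) (n_ t)) a b
       (L (m_ t) (n_ t)) g0) @ \oo --> 0%E.
Proof.
have ba0 : 0 < b - a by rewrite subr_gt0.
(* a larger bound for g0 that also satisfies M1 (b - a) >= 1 *)
pose M1 := Num.max M0 (b - a)^-1.
have g0M1 x : g0 x <= M1 by rewrite le_max hg0_bound.
have kappa1 : 1 <= M1 * (b - a).
  by rewrite -ler_pdivrMr// mul1r le_max lexx orbT.
pose A := 16 * (1 + ln 2 + ln (M1 * (b - a))).
have upper : (fun t => (A * (sigma2 (m_ t) (n_ t)
    * ((n_ t)%:R + (2 ^ L (m_ t) (n_ t))%:R * ln (n_ t).+1%:R)
    / lambda_min ((X (m_ t) (n_ t))^T *m X (m_ t) (n_ t))))%:E) @ \oo --> 0%E.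
  apply: cvg_EFin; first by near=> t.
  rewrite -(mulr0 A); apply: cvgMr; exact: hrate.
have n_gt0 : \forall t \near \oo, (0 < n_ t)%N by exact: (hn _ (nbhs_infty_gt 0)).
apply: (squeeze_cvge _ (cvg_cst 0%E) upper).
near=> t; apply/andP; split.
  rewrite /posterior_mean_risk (true_lawE _ (hsigma2 t) hg0).
  by apply: integral_ge0 => z _; rewrite lee_fin sqnorm2_ge0.
apply: posterior_mean_risk_rate => //.
by near: t.
Unshelve. all: by end_near.
Qed.
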